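(* Let $k$ be a field of characteristic $p>0$ with $\mathbb{F}_q\subseteq k$, $q=p^n$, and let $m\in\mathbb{N}$. Let $K=k(\vec y)$ with $\vec y^{\,q}-\vec y=\vec\alpha\in W_m(k)$ and $\operatorname{Gal}(K/k)\cong W_m(\mathbb{F}_q)$, and let $L=k(\vec z)$ with $\vec z^{\,q}-\vec z=\vec\beta_0\in W_m(k)$. Then $k(\vec y)=k(\vec z)$ if and only if there exist $\vec A_{n-1},\vec A_{n-2},\ldots,\vec A_1,\vec A_0\in W_m(\mathbb{F}_q)$ such that the associated polynomial $$\mathcal{R}(\vec X)=\vec A_{n-1}\cdot\vec X^{p^{n-1}}+\vec A_{n-2}\cdot\vec X^{p^{n-2}}+\cdots+\vec A_1\cdot\vec X^{p}+\vec A_0\cdot\vec X$$ satisfies, for $\vec\beta\in W_m(\mathbb{F}_q)$, $\mathcal{R}(\vec\beta)=\vec 0\iff\vec\beta=\vec 0$, and there exists $\vec D\in W_m(k)$ such that $$\vec z=\mathcal{R}(\vec y)+\vec D.$$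
   Context: $W_m(R)$ denotes the ring of $p$-typical Witt vectors of length $m$ over a commutative ring $R$; all operations $+,-,\cdot$ between Witt vectors are Witt operations. For $\vec x=(x_1,\ldots,x_m)$ and $i\geq 0$, $\vec x^{\,p^i}:=(x_1^{p^i},\ldots,x_m^{p^i})$ (componentwise power, not Witt multiplication), and likewise $\vec x^{\,q}=(x_1^q,\ldots,x_m^q)$. $k(\vec y)$ means $k(y_1,\ldots,y_m)$; $\vec y,\vec z$ are Witt vectors over an algebraic closure of $k$. $W_m(\mathbb{F}_q)\cong(\mathbb{Z}/p^m\mathbb{Z})^n$ as an additive group. *)

(* Defs.v *)
From HB Require Import structures.
From mathcomp Require Import all_boot all_order all_algebra.
From mathcomp Require Import boolp.
From mathcomp Require Import mpoly ring.

Set Implicit Arguments.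
Unset Strict Implicit.
Unset Printing Implicit Defensive.

Import GRing.Theory.
Local Open Scope ring_scope.

(* Components are indexed from 0: the vector (x_1, ..., x_m) has x_(i+1) at
   index i, so that the (i+1)-st ghost component is
   x_1^(p^i) + p x_2^(p^(i-1)) + ... + p^i x_(i+1). *)
Definition ghost (p m : nat) (R : pzSemiRingType) (x : 'I_m -> R) (i : 'I_m) : R :=
  \sum_(j < m | (j <= i)%N) p%:R ^+ j * x j ^+ (p ^ (i - j)).

Section Divisibility.
Variable A : comNzRingType.
Implicit Types N a b c : A.

Definition dvr N a := exists c, a = N * c.

Lemma dvr0 N : dvr N 0.
Proof. by exists 0; rewrite mulr0. Qed.

Lemma dvrD N a b : dvr N a -> dvr N b -> dvr N (a + b).
Proof. by move=> [c ->] [d ->]; exists (c + d); rewrite mulrDr. Qed.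

Lemma dvrN N a : dvr N a -> dvr N (- a).
Proof. by move=> [c ->]; exists (- c); rewrite mulrN. Qed.

Lemma dvrB N a b : dvr N a -> dvr N b -> dvr N (a - b).
Proof. by move=> ha hb; apply: dvrD => //; apply: dvrN. Qed.

Lemma dvrMr N a b : dvr N a -> dvr N (a * b).
Proof. by move=> [c ->]; exists (c * b); rewrite mulrA. Qed.

Lemma dvrMl N a b : dvr N a -> dvr N (b * a).
Proof. by move=> h; rewrite mulrC; apply: dvrMr. Qed.

Lemma dvrM N M a b : dvr N a -> dvr M b -> dvr (N * M) (a * b).
Proof. by move=> [c ->] [d ->]; exists (c * d); rewrite mulrACA. Qed.

Lemma dvr_sum N (I : finType) (P : pred I) (F : I -> A) :
  (forall i, P i -> dvr N (F i)) -> dvr N (\sum_(i | P i) F i).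
Proof. by move=> h; apply: big_ind => //; [exact: dvr0 | exact: dvrD]. Qed.

Lemma dvr_subX N a b n : dvr N (a - b) -> dvr N (a ^+ n - b ^+ n).
Proof. by move=> h; rewrite subrXX; apply: dvrMr. Qed.

Lemma dvr_subM N a a' b b' :
  dvr N (a - a') -> dvr N (b - b') -> dvr N (a * b - a' * b').
Proof.
move=> ha hb; have -> : a * b - a' * b' = (a - a') * b + a' * (b - b').
  by rewrite mulrBl mulrBr addrA subrK.
by apply: dvrD; [apply: dvrMr | apply: dvrMl].
Qed.

Lemma dvr_subXp p e a b :
  dvr (p%:R ^+ e.+1) (a - b) -> dvr (p%:R ^+ e.+2) (a ^+ p - b ^+ p).
Proof.
move=> h; rewrite subrXX exprSr; apply: dvrM => //.
have hp : dvr p%:R (a - b) by case: h => c ->; rewrite exprS -mulrA; exists (p%:R ^+ e * c).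
have -> : \sum_(i < p) a ^+ (p.-1 - i) * b ^+ i =
    \sum_(i < p) (a ^+ (p.-1 - i) * b ^+ i - b ^+ p.-1) + p%:R * b ^+ p.-1.
  by rewrite sumrB sumr_const card_ord mulr_natl subrK.
apply: dvrD; last by exists (b ^+ p.-1).
apply: dvr_sum => i _.
have -> : b ^+ p.-1 = b ^+ (p.-1 - i) * b ^+ i.
  by rewrite -exprD subnK // -ltnS prednK // (leq_ltn_trans _ (ltn_ord i)).
by apply: dvr_subM; [apply: dvr_subX | rewrite subrr; apply: dvr0].
Qed.

Lemma dvr_subXpn p n a b :
  dvr p%:R (a - b) -> dvr (p%:R ^+ n.+1) (a ^+ (p ^ n) - b ^+ (p ^ n)).
Proof.
move=> h; elim: n => [|n IH]; first by rewrite expr1 expn0 !expr1.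
by rewrite expnSr !exprM; apply: dvr_subXp.
Qed.

Lemma dwork p (phi : {rmorphism A -> A}) (G : nat -> A) (n : nat) :
  (forall a, dvr p%:R (phi a - a ^+ p)) ->
  (forall i, i.+1 < n -> dvr (p%:R ^+ i.+1) (G i.+1 - phi (G i)))%N ->
  exists x : nat -> A, forall i, (i < n)%N ->
    \sum_(j < i.+1) p%:R ^+ j * x j ^+ (p ^ (i - j)) = G i.
Proof.
move=> hphi; elim: n => [|n IH] hG; first by exists (fun=> 0).
have [i /ltnW hi|x hx] := IH; first exact: hG.
have [c hc] : dvr (p%:R ^+ n) (G n - \sum_(j < n) p%:R ^+ j * x j ^+ (p ^ (n - j))).
  case: n IH hG hx => [|n] IH hG hx; first by rewrite expr0; eexists; rewrite mul1r.
  rewrite -(subrK (phi (G n)) (G n.+1)) -addrA.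
  apply: dvrD; first exact: hG.
  rewrite -hx // rmorph_sum -sumrB; apply: dvr_sum => j _.
  rewrite rmorphM !rmorphXn /= rmorph_nat -mulrBr.
  have le_jn : (j <= n)%N by rewrite -ltnS.
  have -> : p%:R ^+ n.+1 = p%:R ^+ j * p%:R ^+ (n - j).+1 :> A.
    by rewrite -exprD addnS subnKC.
  apply: dvrM; first by exists 1; rewrite mulr1.
  by rewrite subSn // expnS exprM; apply: dvr_subXpn.
exists (fun j => if j == n then c else x j) => i.
rewrite ltnS leq_eqVlt => /orP[/eqP->|lt_in]; last first.
  rewrite -hx //; apply: eq_bigr => j _; case: eqP => // eqj.
  by move: (ltn_ord j); rewrite eqj ltnS leqNgt lt_in.
rewrite big_ord_recr /= eqxx subnn expn0 expr1 -hc addrC.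
rewrite [X in _ - _ + X](_ : _ = \sum_(j < n) p%:R ^+ j * x j ^+ (p ^ (n - j))).
  by rewrite subrK.
by apply: eq_bigr => j _; rewrite ltn_eqF.
Qed.

End Divisibility.


Section WittPolynomials.
Variables (p : nat) (p_pr : prime p).

Section FrobeniusLift.
Variable N : nat.
Local Notation A := {mpoly int[N]}.

Definition frob_lift : {rmorphism A -> A} :=
  mmap (@mpolyC N int) (fun i => 'X_i ^+ p).

Lemma frob_liftX i : frob_lift 'X_i = 'X_i ^+ p.
Proof. by rewrite /frob_lift /= mmapX mmap1U. Qed.

Lemma frob_liftP a : dvr p%:R (frob_lift a - a ^+ p).
Proof.
have p_gt0 := prime_gt0 p_pr.
pose S b := dvr p%:R (frob_lift b - b ^+ p).
have SXD (b c : A) : dvr p%:R ((b + c) ^+ p - (b ^+ p + c ^+ p)).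
  rewrite exprDn -(prednK p_gt0) big_ord_recl big_ord_recr /= (prednK p_gt0).
  rewrite subn0 expr0 mulr1 bin0.
  have -> : bump 0 p.-1 = p by rewrite /bump add1n prednK.
  rewrite binn subnn expr0 mul1r !mulr1n.
  have -> (u v w : A) : u + (w + v) - (u + v) = w by ring.
  apply: dvr_sum => i _; rewrite -[X in dvr _ X]mulr_natl; apply: dvrMr.
  have /dvdnP[d ->] : (p %| 'C(p, bump 0 i))%N.
    by rewrite prime_dvd_bin // /bump add1n /=; have := ltn_ord i; rewrite -ltnS prednK.
  by rewrite mulnC natrM; exists d%:R.
have SM b c : S b -> S c -> S (b * c).
  by move=> hb hc; rewrite /S rmorphM exprMn; apply: dvr_subM.
have SD b c : S b -> S c -> S (b + c).
  move=> hb hc; rewrite /S rmorphD.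
  have sub_split (u u' v v' w : A) :
    u + u' - w = (u - v) + (u' - v') - (w - (v + v')) by ring.
  rewrite (sub_split _ _ (b ^+ p) (c ^+ p)).
  by apply: dvrB => //; apply: dvrD.
have S1 : S 1 by rewrite /S rmorph1 expr1n subrr; apply: dvr0.
have S0 : S 0 by rewrite /S rmorph0 expr0n gtn_eqF // subrr; apply: dvr0.
have SN b : S b -> S (- b).
  move=> hb; have := dvrB (SXD b (- b)) hb.
  rewrite /S subrr expr0n gtn_eqF //= sub0r rmorphN.
  have -> (u v w : A) : - (v + w) - (u - v) = - u - w by ring.
  by [].
have Sn n : S n%:R by elim: n => [|n IH] //; rewrite mulrS; apply: SD.
have Sc (c : int) : S c%:MP.
  have -> : c%:MP = c%:~R :> A by rewrite -[c in LHS]intz rmorph_int.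
  by case: c => n; [exact: Sn | rewrite NegzE mulrNz; apply/SN/Sn].
have SX i : S 'X_i by rewrite /S frob_liftX subrr; apply: dvr0.
suff : S a by [].
clearbody S.
apply: (mpolyind (P := S)) => [|c m q _ _ IH]; first exact: S0.
apply: SD => //; rewrite -mul_mpolyC; apply: (SM) => //.
rewrite mpolyXE_id; apply: (big_rec S) => // i b _; apply: (SM) => //.
elim: (m i) => [|d IHd]; first by rewrite expr0.
by rewrite exprS; apply: SM.
Qed.

End FrobeniusLift.

Section Existence.
Variables (N m : nat).
Local Notation A := {mpoly int[N]}.

Lemma ex_ghost (G : 'I_m -> A) :
  (forall i j : 'I_m, i = j.+1 :> nat ->
     dvr (p%:R ^+ i) (G i - frob_lift N (G j))) ->
  exists S : {ffun 'I_m -> A}, [forall i, ghost p S i == G i].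
Proof.
move=> hG; pose G' i := if insub i is Some j then G j else 0.
have G'E (i : 'I_m) : G' i = G i by rewrite /G' valK.
have [|x hx] := @dwork A p (frob_lift N) G' m (@frob_liftP N).
  move=> i lt_im; rewrite (G'E (Ordinal lt_im)) (G'E (Ordinal (ltnW lt_im))).
  exact: hG.
exists [ffun i : 'I_m => x i]; apply/forallP => i.
rewrite -G'E -hx // /ghost; apply/eqP.
rewrite (big_ord_widen m (fun j => p%:R ^+ j * x j ^+ (p ^ (i - j)))) //.
by apply: eq_bigr => j _; rewrite ffunE.
Qed.

Lemma dvr_ghostX (h : 'I_m -> 'I_N) (i j : 'I_m) : i = j.+1 :> nat ->
  dvr (p%:R ^+ i : A) (ghost p (fun l => 'X_(h l)) i
                  - frob_lift N (ghost p (fun l => 'X_(h l)) j)).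
Proof.
move=> eq_ij; rewrite /ghost (bigD1 i) //= rmorph_sum /= -addrA; apply: dvrD.
  by exists ('X_(h i) ^+ (p ^ (i - i))).
rewrite (eq_bigl (fun l : 'I_m => l <= j)%N); last first.
  by move=> l; rewrite andbC -[l != i]/(l != i :> nat) -ltn_neqAle eq_ij ltnS.
rewrite -sumrB; apply: dvr_sum => l le_lj.
rewrite rmorphM !rmorphXn /= rmorph_nat frob_liftX eq_ij.
by rewrite subSn // expnS exprM subrr; apply: dvr0.
Qed.

End Existence.

End WittPolynomials.

(* The ring structure on W_m(R) needs p to be prime, so that the proof of
   primality is a parameter of the type; the alias prevents the pointwise
   operations of {ffun 'I_m -> R} from being inferred. *)
Definition witt (p : nat) (p_pr : prime p) (m : nat) (R : Type) : Type :=
  {ffun 'I_m -> R}.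

Section WittVectors.
Variables (p : nat) (p_pr : prime p) (m : nat).

Section Polynomials.
Let X (i : 'I_m) : {mpoly int[m + m]} := 'X_(lshift m i).
Let Y (i : 'I_m) : {mpoly int[m + m]} := 'X_(rshift m i).
Let Z (i : 'I_m) : {mpoly int[m]} := 'X_i.

(* The integer polynomials below are characterised uniquely by the equations
   on ghost components, as {mpoly int[_]} has no p-torsion. *)
Fact witt_add_poly_subproof : {S : {ffun 'I_m -> {mpoly int[m + m]}} |
  forall i, ghost p S i = ghost p X i + ghost p Y i}.
Proof.
have ex_S : exists S : {ffun 'I_m -> {mpoly int[m + m]}},
  [forall i, ghost p S i == ghost p X i + ghost p Y i].
  apply: ex_ghost => // i j ij; rewrite rmorphD opprD addrACA.
  by apply: dvrD; apply: dvr_ghostX.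
by exists (xchoose ex_S) => i; have /forallP/(_ i)/eqP := xchooseP ex_S.
Qed.
Definition witt_add_poly := sval witt_add_poly_subproof.
Definition ghost_witt_add_poly : forall i, ghost p witt_add_poly i = ghost p X i + ghost p Y i :=
  svalP witt_add_poly_subproof.

Fact witt_mul_poly_subproof : {S : {ffun 'I_m -> {mpoly int[m + m]}} |
  forall i, ghost p S i = ghost p X i * ghost p Y i}.
Proof.
have ex_S : exists S : {ffun 'I_m -> {mpoly int[m + m]}},
  [forall i, ghost p S i == ghost p X i * ghost p Y i].
  apply: ex_ghost => // i j ij; rewrite rmorphM.
  by apply: dvr_subM; apply: dvr_ghostX.
by exists (xchoose ex_S) => i; have /forallP/(_ i)/eqP := xchooseP ex_S.
Qed.
Definition witt_mul_poly := sval witt_mul_poly_subproof.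
Definition ghost_witt_mul_poly : forall i, ghost p witt_mul_poly i = ghost p X i * ghost p Y i :=
  svalP witt_mul_poly_subproof.

Fact witt_opp_poly_subproof : {S : {ffun 'I_m -> {mpoly int[m]}} |
  forall i, ghost p S i = - ghost p Z i}.
Proof.
have ex_S : exists S : {ffun 'I_m -> {mpoly int[m]}},
  [forall i, ghost p S i == - ghost p Z i].
  apply: ex_ghost => // i j ij; rewrite rmorphN -opprD.
  by apply: dvrN; apply: dvr_ghostX.
by exists (xchoose ex_S) => i; have /forallP/(_ i)/eqP := xchooseP ex_S.
Qed.
Definition witt_opp_poly := sval witt_opp_poly_subproof.
Definition ghost_witt_opp_poly : forall i, ghost p witt_opp_poly i = - ghost p Z i :=
  svalP witt_opp_poly_subproof.

End Polynomials.

Definition paste T (x y : 'I_m -> T) (j : 'I_(m + m)) : T :=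
  match split j with inl i => x i | inr i => y i end.

Lemma paste_l T (x y : 'I_m -> T) i : paste x y (lshift m i) = x i.
Proof. by rewrite /paste (unsplitK (inl i)). Qed.

Lemma paste_r T (x y : 'I_m -> T) i : paste x y (rshift m i) = y i.
Proof. by rewrite /paste (unsplitK (inr i)). Qed.

Local Notation W := (witt p_pr m).

HB.instance Definition _ (R : choiceType) := Choice.on (W R).
HB.instance Definition _ (R : finType) := Finite.on (W R).

Definition witt_map (R S : Type) (f : R -> S) (x : W R) : W S :=
  [ffun i => f (x i)].

Lemma ghost_rmorph (R S : comNzRingType) (f : {rmorphism R -> S})
    (x : 'I_m -> R) i : f (ghost p x i) = ghost p (fun j => f (x j)) i.
Proof.
rewrite rmorph_sum; apply: eq_bigr => j _.
by rewrite rmorphM !rmorphXn /= rmorph_nat.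
Qed.

Lemma eq_ghost (R : comNzRingType) (x y : 'I_m -> R) : x =1 y -> ghost p x =1 ghost p y.
Proof. by move=> e i; apply: eq_bigr => j _; rewrite e. Qed.

Fact witt_key : unit. Proof. by []. Qed.

Section Operations.
Variable R : comNzRingType.
Implicit Types x y z : W R.

Definition witt_zero : W R := [ffun => 0].
Definition witt_one : W R := [ffun i : 'I_m => (i == 0 :> nat)%:R].
(* Locked, lest unification unfold the universal polynomials. *)
Definition witt_opp : W R -> W R := locked_with witt_key (fun x =>
  [ffun i => mmap (intmul 1) x (witt_opp_poly i)]).
Definition witt_add : W R -> W R -> W R := locked_with witt_key (fun x y =>
  [ffun i => mmap (intmul 1) (paste x y) (witt_add_poly i)]).
Definition witt_mul : W R -> W R -> W R := locked_with witt_key (fun x y =>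
  [ffun i => mmap (intmul 1) (paste x y) (witt_mul_poly i)]).

Lemma witt_oppE x i : witt_opp x i = mmap (intmul 1) x (witt_opp_poly i).
Proof. by rewrite /witt_opp locked_withE ffunE. Qed.

Lemma witt_addE x y i :
  witt_add x y i = mmap (intmul 1) (paste x y) (witt_add_poly i).
Proof. by rewrite /witt_add locked_withE ffunE. Qed.

Lemma witt_mulE x y i :
  witt_mul x y i = mmap (intmul 1) (paste x y) (witt_mul_poly i).
Proof. by rewrite /witt_mul locked_withE ffunE. Qed.

Lemma ghost0 i : ghost p witt_zero i = 0.
Proof.
rewrite /ghost big1 // => j _.
by rewrite ffunE expr0n expn_eq0 (gtn_eqF (prime_gt0 p_pr)) mulr0.
Qed.

Lemma ghost1 i : ghost p witt_one i = 1.
Proof.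
have m_gt0 : (0 < m)%N by apply: leq_ltn_trans (ltn_ord i).
rewrite /ghost (bigD1 (Ordinal m_gt0)) //= ffunE /= expr1n mulr1 big1 ?addr0 //.
move=> j /andP[_ j_neq0]; rewrite ffunE -[_ == _ :> nat]/(j == Ordinal m_gt0).
by rewrite (negPf j_neq0) expr0n expn_eq0 (gtn_eqF (prime_gt0 p_pr)) mulr0.
Qed.

Lemma ghostN x i : ghost p (witt_opp x) i = - ghost p x i.
Proof.
have := congr1 (mmap (intmul 1) x) (ghost_witt_opp_poly i).
rewrite rmorphN !ghost_rmorph /= => e.
rewrite (eq_ghost (witt_oppE x)) e; congr (- _).
by apply: eq_ghost => j; rewrite mmapX mmap1U.
Qed.

Lemma ghostD x y i : ghost p (witt_add x y) i = ghost p x i + ghost p y i.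
Proof.
have := congr1 (mmap (intmul 1) (paste x y)) (ghost_witt_add_poly i).
rewrite rmorphD !ghost_rmorph /= => e.
rewrite (eq_ghost (witt_addE x y)) e; congr (_ + _).
  by apply: eq_ghost => j; rewrite mmapX mmap1U paste_l.
by apply: eq_ghost => j; rewrite mmapX mmap1U paste_r.
Qed.

Lemma ghostM x y i : ghost p (witt_mul x y) i = ghost p x i * ghost p y i.
Proof.
have := congr1 (mmap (intmul 1) (paste x y)) (ghost_witt_mul_poly i).
rewrite rmorphM !ghost_rmorph /= => e.
rewrite (eq_ghost (witt_mulE x y)) e; congr (_ * _).
  by apply: eq_ghost => j; rewrite mmapX mmap1U paste_l.
by apply: eq_ghost => j; rewrite mmapX mmap1U paste_r.
Qed.

End Operations.

Lemma rmorph_mmap_int (R S : comNzRingType) (f : {rmorphism R -> S}) N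
    (h : 'I_N -> R) (P : {mpoly int[N]}) :
  f (mmap (intmul 1) h P) = mmap (intmul 1) (fun i => f (h i)) P.
Proof.
rewrite /mmap rmorph_sum; apply: eq_bigr => u _.
rewrite rmorphM /= rmorph_int rmorph_prod; congr (_ * _).
by apply: eq_bigr => i _; rewrite rmorphXn.
Qed.

Lemma eq_mmap_int (R : comNzRingType) N (h h' : 'I_N -> R) (P : {mpoly int[N]}) :
  h =1 h' -> mmap (intmul 1) h P = mmap (intmul 1) h' P.
Proof.
by move=> e; apply: eq_bigr => u _; congr (_ * _); apply: mmap1_eq.
Qed.

Section Functoriality.
Variables (R S : comNzRingType) (f : {rmorphism R -> S}).
Implicit Types x y : W R.

Lemma paste_map x y : (fun j => f (paste x y j)) =1 paste (witt_map f x) (witt_map f y).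
Proof. by move=> j; rewrite /paste; case: split => i; rewrite ffunE. Qed.

Lemma witt_map0 : witt_map f (witt_zero R) = witt_zero S.
Proof. by apply/ffunP => i; rewrite !ffunE rmorph0. Qed.

Lemma witt_map1 : witt_map f (witt_one R) = witt_one S.
Proof. by apply/ffunP => i; rewrite !ffunE rmorph_nat. Qed.

Lemma witt_mapN x : witt_map f (witt_opp x) = witt_opp (witt_map f x).
Proof.
apply/ffunP => i; rewrite ffunE !witt_oppE rmorph_mmap_int.
by apply: eq_mmap_int => j; rewrite ffunE.
Qed.

Lemma witt_mapD x y :
  witt_map f (witt_add x y) = witt_add (witt_map f x) (witt_map f y).
Proof.
by apply/ffunP => i; rewrite ffunE !witt_addE rmorph_mmap_int; apply/eq_mmap_int/paste_map.
Qed.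

Lemma witt_mapM x y :
  witt_map f (witt_mul x y) = witt_mul (witt_map f x) (witt_map f y).
Proof.
by apply/ffunP => i; rewrite ffunE !witt_mulE rmorph_mmap_int; apply/eq_mmap_int/paste_map.
Qed.

End Functoriality.

Lemma ghost_inj (R : comNzRingType) (x y : W R) :
  (forall a b : R, p%:R * a = p%:R * b -> a = b) ->
  ghost p x =1 ghost p y -> x = y.
Proof.
move=> p_reg e; apply/ffunP => i.
elim/ltn_ind: {i}(val i : nat) {-2}i (erefl (val i)) => n IH i eq_in.
have := e i; rewrite /ghost (bigD1 i) //= [RHS](bigD1 i) //= subnn !expr1.
rewrite [X in _ + X = _](eq_bigr (fun j => p%:R ^+ nat_of_ord j * y j ^+ (p ^ (i - j)))).
  by move/addIr; elim: (nat_of_ord i) => [|d IHd]; rewrite ?mul1r // exprS -!mulrA => /p_reg.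
move=> j /andP[le_ji neq_ji]; rewrite (IH j) // -eq_in ltn_neqAle le_ji andbT.
by rewrite -val_eqE in neq_ji.
Qed.

Lemma mpoly_int_preg N (a b : {mpoly int[N]}) : p%:R * a = p%:R * b -> a = b.
Proof.
apply: mulfI; rewrite -mpolyC_nat mpolyC_eq0 natz.
by rewrite eqz_nat -lt0n prime_gt0.
Qed.

Section Transfer.
Variables (R : comNzRingType) (x y z : W R).

Lemma witt_lift3 : exists N (f : {rmorphism {mpoly int[N]} -> R})
    (x' y' z' : W {mpoly int[N]}),
  [/\ x = witt_map f x', y = witt_map f y' & z = witt_map f z'].
Proof.
pose T := (m + m + (m + m))%N.
pose h (j : 'I_T) := match split j with
  inl i => paste x y i | inr i => paste z z i end.
exists T, (mmap (intmul 1) h).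
exists [ffun i => 'X_(lshift _ (lshift _ i))], [ffun i => 'X_(lshift _ (rshift _ i))],
  [ffun i => 'X_(rshift _ (lshift _ i))].
by split; apply/ffunP => i; rewrite !ffunE /= mmapX mmap1U /h
  ?(unsplitK (inl _)) ?(unsplitK (inr _)) ?paste_l ?paste_r.
Qed.

End Transfer.

Section RingAxioms.
Variable R : comNzRingType.

Local Ltac torsion_free f :=
  rewrite -?(witt_map0 f) -?(witt_map1 f) -?(witt_mapN, witt_mapD, witt_mapM);
  apply: (congr1 (witt_map f)); apply: ghost_inj; [exact: mpoly_int_preg | move=> i];
  rewrite ?(ghostD, ghostM, ghostN, ghost0, ghost1).

Lemma witt_addA : associative (@witt_add R).
Proof.
move=> x y z; have [N [f [x' [y' [z' [-> -> ->]]]]]] := witt_lift3 x y z.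
by torsion_free f; apply: addrA.
Qed.

Lemma witt_addC : commutative (@witt_add R).
Proof.
move=> x y; have [N [f [x' [y' [z' [-> -> ->]]]]]] := witt_lift3 x y y.
by torsion_free f; apply: addrC.
Qed.

Lemma witt_add0 : left_id (witt_zero R) (@witt_add R).
Proof.
move=> x; have [N [f [x' [y' [z' [-> -> ->]]]]]] := witt_lift3 x x x.
by torsion_free f; apply: add0r.
Qed.

Lemma witt_addN : left_inverse (witt_zero R) (@witt_opp R) (@witt_add R).
Proof.
move=> x; have [N [f [x' [y' [z' [-> -> ->]]]]]] := witt_lift3 x x x.
by torsion_free f; apply: addNr.
Qed.

Lemma witt_mulA : associative (@witt_mul R).
Proof.
move=> x y z; have [N [f [x' [y' [z' [-> -> ->]]]]]] := witt_lift3 x y z.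
by torsion_free f; apply: mulrA.
Qed.

Lemma witt_mulC : commutative (@witt_mul R).
Proof.
move=> x y; have [N [f [x' [y' [z' [-> -> ->]]]]]] := witt_lift3 x y y.
by torsion_free f; apply: mulrC.
Qed.

Lemma witt_mul1 : left_id (witt_one R) (@witt_mul R).
Proof.
move=> x; have [N [f [x' [y' [z' [-> -> ->]]]]]] := witt_lift3 x x x.
by torsion_free f; apply: mul1r.
Qed.

Lemma witt_mulD : left_distributive (@witt_mul R) (@witt_add R).
Proof.
move=> x y z; have [N [f [x' [y' [z' [-> -> ->]]]]]] := witt_lift3 x y z.
by torsion_free f; apply: mulrDl.
Qed.

HB.instance Definition _ :=
  GRing.isZmodule.Build (W R) witt_addA witt_addC witt_add0 witt_addN.
HB.instance Definition _ :=
  GRing.Zmodule_isComPzRing.Build (W R) witt_mulA witt_mulC witt_mul1 witt_mulD.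

End RingAxioms.

Definition witt_pow (R : comNzRingType) (x : W R) (e : nat) : W R :=
  [ffun i => x i ^+ e].

(* R(X) = A_(n-1) . X^(p^(n-1)) + ... + A_1 . X^p + A_0 . X *)
Definition assoc_poly (R : comNzRingType) (n : nat) (A : 'I_n -> W R) (x : W R) : W R :=
  \sum_(i < n) A i * witt_pow x (p ^ i).

End WittVectors.

Section Adjunction.
Variables (k E : fieldType) (iota : {rmorphism k -> E}) (I : Type) (y : I -> E).

Definition adjoin : {pred E} := fun u => `[< forall F : {pred E},
  divring_closed F -> (forall c, iota c \in F) -> (forall i, y i \in F) -> u \in F >].

Lemma adjoin_divring_closed : divring_closed adjoin.
Proof.
split; first by apply/asboolP => F [].
  move=> u v /asboolP hu /asboolP hv; apply/asboolP => F F_closed Fk Fy.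
  by case: (F_closed) => _ F_sub _; apply: F_sub; [apply: hu | apply: hv].
move=> u v /asboolP hu /asboolP hv; apply/asboolP => F F_closed Fk Fy.
by case: (F_closed) => _ _ F_div; apply: F_div; [apply: hu | apply: hv].
Qed.
HB.instance Definition _ := GRing.isDivringClosed.Build E adjoin adjoin_divring_closed.

Lemma adjoin_base c : iota c \in adjoin.
Proof. by apply/asboolP. Qed.

Definition adjoin_field : Type := {u : E | u \in adjoin}.
HB.instance Definition _ := [isSub for (@sval E _ : adjoin_field -> E)].
HB.instance Definition _ := [Choice of adjoin_field by <:].
HB.instance Definition _ := [SubChoice_isSubIntegralDomain of adjoin_field by <:].
HB.instance Definition _ := [SubIntegralDomain_isSubField of adjoin_field by <:].

Definition in_adjoin_field (c : k) : adjoin_field := exist _ (iota c) (adjoin_base c).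

End Adjunction.

Section GaloisGroup.
Variables (k K : fieldType) (j : k -> K).

(* Automorphisms of K that fix the image of k; this is the Galois group of
   K / k when that extension is Galois. *)
Record Gal := MkGal {
  gal_fun :> K -> K;
  gal_additive : zmod_morphism gal_fun;
  gal_multiplicative : monoid_morphism gal_fun;
  gal_bij : bijective gal_fun;
  gal_fix : forall c, gal_fun (j c) = j c }.

Lemma gal_eq (s t : Gal) : s =1 t -> s = t.
Proof.
case: s t => [f fA fM fB fj] [g gA gM gB gj] /= /funext e; subst g.
by congr MkGal; apply: Prop_irrelevance.
Qed.

Definition gal_one : Gal.
Proof. by exists id => //; exists id. Defined.

Definition gal_mul (s t : Gal) : Gal.
Proof.
exists (s \o t).
- by move=> x y /=; rewrite !gal_additive.
- by split=> [|x y] /=; rewrite !gal_multiplicative.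
- by apply: bij_comp; apply: gal_bij.
- by move=> c /=; rewrite !gal_fix.
Defined.

Lemma gal_inv_subproof (s : Gal) : {g : K -> K | cancel s g & cancel g s}.
Proof.
by apply: cid2; case: (gal_bij s) => g sK gK; exists g.
Qed.

Definition gal_inv (s : Gal) : Gal.
Proof.
case: (gal_inv_subproof s) => g sK gK; exists g.
- by move=> x y; apply: (can_inj sK); rewrite gal_additive !gK.
- by split=> [|x y]; apply: (can_inj sK); rewrite gal_multiplicative !gK.
- by exists s.
- by move=> c; apply: (can_inj sK); rewrite gal_fix gK.
Defined.

HB.instance Definition _ := gen_eqMixin Gal.
HB.instance Definition _ := gen_choiceMixin Gal.

Fact gal_mulA : associative gal_mul.
Proof. by move=> s t u; apply: gal_eq. Qed.

Fact gal_mul1 : left_id gal_one gal_mul.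
Proof. by move=> s; apply: gal_eq. Qed.

Fact gal_mulr1 : right_id gal_one gal_mul.
Proof. by move=> s; apply: gal_eq. Qed.

Fact gal_mulV : left_inverse gal_one gal_inv gal_mul.
Proof.
move=> s; apply: gal_eq => x; rewrite /gal_inv /=.
by case: (gal_inv_subproof s) => g sK gK /=; rewrite sK.
Qed.

Fact gal_mulrV : right_inverse gal_one gal_inv gal_mul.
Proof.
move=> s; apply: gal_eq => x; rewrite /gal_inv /=.
by case: (gal_inv_subproof s) => g sK gK /=; rewrite gK.
Qed.

HB.instance Definition _ :=
  isGroup.Build Gal gal_mulA gal_mul1 gal_mulr1 gal_mulV gal_mulrV.

End GaloisGroup.

(* Main.v *)
From HB Require Import structures.
From mathcomp Require Import all_boot all_order all_algebra fieldext finfield.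
From mathcomp Require Import boolp mpoly.
Require Import Defs.

(** Write [q = p ^ n], [W] for Witt vectors of length [m] and [K = k(y)]. If [s] is
    an automorphism of [K] over [k], then [s y - y] is fixed by [x |-> x ^ q], so it
    lies in [W(F_q)]. This gives an injective additive character [shift y] of the
    Galois group, and it is bijective because the group has as many elements as
    [W(F_q)]. Any solution [z] in [W(K)] of [z ^ q - z = beta0] has a character
    [shift z] as well, and [shift (R z) = R (shift z)] for an associated polynomial
    [R] with coefficients in [W(F_q)]. Two facts then give the theorem.

    - [additive_assoc_poly]: every additive map from [W(F_q)] to itself is an
      associated polynomial. For length one this is the statement that additive
      functions on [F_q] are [p]-polynomials of degree less than [q]
      ([additive_fun_poly]). In general the map is approximated one component at a
      time, using that the leading components of sums and products of Witt vectors
      are sums and products ([witt_add_vanish], [witt_mul_vanish]).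

    - [fixed_field]: the elements of [K] fixed by the Galois group are those of [k].
      The components of [y] generate a tower of Artin-Schreier extensions; a fixed
      element is a polynomial of degree less than [q] in the last component, and
      translations by [W(F_q)] show that it takes the same value at [q] points, hence
      is constant.

    If [k(y) = k(z)], both characters are bijective. The map that sends [shift y s]
    to [shift z s] is additive, hence equal to some [R], and [z - R y] is fixed by the
    Galois group: it is [D]. Conversely, if [z = R y + D] with [R] injective on
    [W(F_q)], the inverse of [R] on [W(F_q)] is additive, hence an associated
    polynomial [R'], and [y - R' z] is fixed. So [y] is [R' z] plus a vector over [k],
    and each of [y], [z] has its components in the field generated by the other. *)

Set Implicit Arguments.
Unset Strict Implicit.
Unset Printing Implicit Defensive.

Import GRing.Theory.
Local Open Scope ring_scope.

(** * Leading components of sums and products of Witt vectors *)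

Section LeadingComponents.
Variables (p : nat) (p_pr : prime p) (m : nat).
Local Notation W := (witt p_pr m).

(** The filtration of Witt vectors by the images of the iterates of Verschiebung. *)
Definition vanish_below (R : pzSemiRingType) (s : nat) (x : W R) :=
  forall i : 'I_m, (i < s)%N -> x i = 0.

Lemma vanish0 (R : comNzRingType) s : vanish_below s (0 : W R).
Proof. by move=> i _; rewrite ffunE. Qed.

Lemma vanish_all (R : comNzRingType) s (x : W R) :
  (m <= s)%N -> vanish_below s x -> x = 0.
Proof.
move=> le_ms x0; apply/ffunP => i; rewrite x0 ?ffunE //.
exact: leq_trans (ltn_ord i) le_ms.
Qed.

Lemma ghost_vanish (R : comNzRingType) (x : W R) s (i : 'I_m) :
  vanish_below s x -> (i <= s)%N -> ghost p x i = p%:R ^+ i * x i.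
Proof.
move=> x0 le_is; rewrite /ghost (bigD1 i) //= subnn expr1 big1 ?addr0 //.
move=> j /andP[le_ji ne_ji].
have lt_ji : (j < i)%N by rewrite ltn_neqAle -(inj_eq val_inj) in ne_ji *; rewrite ne_ji.
rewrite x0 ?(leq_trans lt_ji) // expr0n expn_eq0 (gtn_eqF (prime_gt0 p_pr)).
by rewrite mulr0.
Qed.

Lemma ghost_split (R : comNzRingType) (x : W R) (i : 'I_m) :
  ghost p x i = p%:R ^+ i * x i +
    \sum_(j < m | (j < i)%N) p%:R ^+ j * x j ^+ (p ^ (i - j)).
Proof.
rewrite /ghost (bigD1 i) //= subnn expr1; congr (_ + _); apply: eq_bigl => j.
by rewrite ltn_neqAle andbC.
Qed.

Lemma preg_pow (R : comNzRingType) s (a b : R) :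
  (forall a b : R, p%:R * a = p%:R * b -> a = b) ->
  p%:R ^+ s * a = p%:R ^+ s * b -> a = b.
Proof.
by move=> pR; elim: s => [|s IH]; rewrite ?mul1r // exprS -!mulrA => /pR /IH.
Qed.

Lemma ghost_inj_upto (R : comNzRingType) (x y : W R) s :
  (forall a b : R, p%:R * a = p%:R * b -> a = b) ->
  (forall i : 'I_m, (i < s)%N -> ghost p x i = ghost p y i) ->
  forall i : 'I_m, (i < s)%N -> x i = y i.
Proof.
move=> p_reg e i; move: {2}(val i) (leqnn i) => n.
elim: n i => [|n IH] i le_in lt_is; have := e i lt_is; rewrite !ghost_split.
  rewrite !big_pred0; try by move=> j; case: (i : nat) le_in.
  by rewrite !addr0; apply: preg_pow.
rewrite [X in _ + X = _](eq_bigr (fun j => p%:R ^+ nat_of_ord j * y j ^+ (p ^ (i - j)))).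
  by move/addIr; apply: preg_pow.
move=> j lt_ji; rewrite (IH j) //; last exact: ltn_trans lt_is.
by rewrite -ltnS (leq_trans lt_ji).
Qed.

(** Witt vector identities in terms of components are read off from ghost
    components, which needs a ring without [p]-torsion. A pair of Witt vectors
    lifts to such a ring, and zero components can be lifted to zero. *)
Lemma vanish_lift (R : comNzRingType) s (x y : W R) : vanish_below s x ->
  exists (S : comNzRingType) (f : {rmorphism S -> R}) (x' y' : W S),
  [/\ forall a b : S, p%:R * a = p%:R * b -> a = b,
      x = witt_map f x', y = witt_map f y' & vanish_below s x'].
Proof.
move=> x0; have [N [f [x' [y' [_ [ex ey _]]]]]] := witt_lift3 x y y.
exists {mpoly int[N]}, f, [ffun i : 'I_m => if (i < s)%N then 0 else x' i], y'; split=> //.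
- exact: mpoly_int_preg.
- apply/ffunP => i; rewrite !ffunE; case: ifP => [/x0 ->|_]; first by rewrite rmorph0.
  by rewrite ex ffunE.
- by move=> i lt_is; rewrite ffunE lt_is.
Qed.

(** Over a ring without [p]-torsion, if [x] vanishes below [i] then the [i]-th
    ghost component of [x + y] is that of [y] plus [p ^ i * x i], while the lower
    ghost components, hence the lower components, of [x + y] and [y] agree. *)
Lemma witt_add_vanish (R : comNzRingType) s (x y : W R) (i : 'I_m) :
  vanish_below s x -> (i <= s)%N -> (x + y) i = x i + y i.
Proof.
move=> x0 le_is; have [S [f [u [v [S_reg -> -> u0]]]]] := vanish_lift y x0.
rewrite -[_ + _]/(witt_add _ _) -witt_mapD !ffunE -rmorphD; congr (f _).
have gh (j : 'I_m) : (j <= s)%N -> ghost p (witt_add u v) j = p%:R ^+ j * u j + ghost p v j.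
  by move=> le_js; rewrite ghostD (ghost_vanish u0).
have lo := @ghost_inj_upto S (witt_add u v) v i S_reg.
have {}lo (j : 'I_m) : (j < i)%N -> witt_add u v j = v j.
  apply: lo => l lt_li; rewrite gh ?u0 ?mulr0 ?add0r //;
  by rewrite ?(leq_trans (ltnW lt_li)) // (leq_trans lt_li).
have := gh i le_is; rewrite !ghost_split addrA -mulrDr.
rewrite [X in _ + X = _](eq_bigr (fun j => p%:R ^+ nat_of_ord j * v j ^+ (p ^ (i - j)))).
  by move/addIr; apply: preg_pow.
by move=> j /lo ->.
Qed.

Lemma vanish_add (R : comNzRingType) s (x y : W R) :
  vanish_below s x -> vanish_below s y -> vanish_below s (x + y).
Proof.
by move=> x0 y0 i lt_is; rewrite (witt_add_vanish y x0 (ltnW lt_is)) x0 ?y0 ?addr0.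
Qed.

Lemma vanish_sub (R : comNzRingType) s (x y : W R) :
  (forall i : 'I_m, (i < s)%N -> x i = y i) -> vanish_below s (x - y).
Proof.
elim: s => // s IH e i.
have d0 : vanish_below s (x - y) by apply: IH => j lt_js; apply/e/ltnW.
rewrite ltnS => le_is; have := witt_add_vanish y d0 le_is.
by rewrite subrK e // => /(canLR (addrK _)); rewrite subrr.
Qed.

(** If [x] and [x'] agree up to [i], their difference vanishes below [i + 1], so
    that adding it changes no component up to [i]. *)
Lemma witt_add_agree (R : comNzRingType) (x x' y : W R) (i : 'I_m) :
  (forall j : 'I_m, (j <= i)%N -> x j = x' j) -> (x + y) i = (x' + y) i.
Proof.
move=> e; have d0 := @vanish_sub R i.+1 x x' e.
rewrite -[x](subrK x') -addrA (witt_add_vanish (x' + y) d0) ?leqnSn //.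
by rewrite d0 // add0r.
Qed.

Lemma witt_mul_vanish (R : comNzRingType) s (x y : W R) (i : 'I_m) :
  vanish_below s x -> (i <= s)%N -> (x * y) i = x i * ghost p y i.
Proof.
move=> x0 le_is; have [S [f [u [v [S_reg -> -> u0]]]]] := vanish_lift y x0.
rewrite -[_ * _]/(witt_mul _ _) -witt_mapM !ffunE.
rewrite -(@eq_ghost p m R (fun j => f (v j))) => [|j]; last by rewrite ffunE.
rewrite -ghost_rmorph -rmorphM; congr (f _).
have gh (j : 'I_m) : (j <= s)%N -> ghost p (witt_mul u v) j = p%:R ^+ j * (u j * ghost p v j).
  by move=> le_js; rewrite ghostM (ghost_vanish u0) // mulrA.
have lo : vanish_below i (witt_mul u v).
  move=> j lt_ji; rewrite (@ghost_inj_upto S (witt_mul u v) (witt_zero _ _ _) i S_reg) ?ffunE //.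
  move=> l lt_li; rewrite ghost0 gh ?u0 ?mul0r ?mulr0 //.
    exact: leq_trans lt_li le_is.
  exact: leq_trans (ltnW lt_li) le_is.
by have := gh i le_is; rewrite (ghost_vanish lo) //; apply: preg_pow.
Qed.

Lemma vanish_mul (R : comNzRingType) s (x y : W R) :
  vanish_below s x -> vanish_below s (x * y).
Proof.
by move=> x0 i lt_is; rewrite (witt_mul_vanish y x0 (ltnW lt_is)) x0 ?mul0r.
Qed.

Lemma ghost_pchar (R : comNzRingType) (x : W R) (i i0 : 'I_m) :
  p \in [pchar R] -> i0 = 0 :> nat -> ghost p x i = x i0 ^+ (p ^ i).
Proof.
move=> charR i00; rewrite /ghost (bigD1 i0) ?i00 //= mul1r subn0 big1 ?addr0 //.
move=> j /andP[_ ne_j0]; rewrite (pcharf0 charR) expr0n.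
have -> : (j == 0 :> nat) = false.
  by apply/negbTE; move: ne_j0; rewrite -(inj_eq val_inj) /= i00.
by rewrite mul0r.
Qed.

Lemma vanish_sum (R : comNzRingType) s (I : finType) (F : I -> W R) :
  (forall a, vanish_below s (F a)) -> vanish_below s (\sum_a F a).
Proof.
by move=> F0; apply: big_ind => //; [exact: vanish0 | exact: vanish_add].
Qed.

Lemma witt_sum_vanish (R : comNzRingType) s (I : finType) (F : I -> W R) (i : 'I_m) :
  (forall a, vanish_below s (F a)) -> (i <= s)%N -> (\sum_a F a) i = \sum_a F a i.
Proof.
move=> F0 le_is.
suff [] : vanish_below s (\sum_a F a) /\ (\sum_a F a) i = \sum_a F a i by [].
elim/big_ind2: _ => [|x a y b [x0 ex] [y0 ey]|a _]; last by split.
  by split; [exact: vanish0 | rewrite ffunE].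
by split; [exact: vanish_add | rewrite (witt_add_vanish _ x0) // ex ey].
Qed.

(** Dwork's congruence read backwards: ghost components that are congruent modulo
    increasing powers of [p] come from components that are congruent modulo [p].
    At each step, [dvr_subXpn] turns congruences between lower components into
    congruences between the terms that they contribute. *)
Lemma ghost_dvr (R : comNzRingType) (x y : W R) :
  (forall a b : R, p%:R * a = p%:R * b -> a = b) ->
  (forall i : 'I_m, dvr (p%:R ^+ i.+1) (ghost p x i - ghost p y i)) ->
  forall i, dvr p%:R (x i - y i).
Proof.
move=> p_reg e i; move: {2}(val i) (leqnn i) => n.
have step (l : 'I_m) : (forall j : 'I_m, (j < l)%N -> dvr p%:R (x j - y j)) ->
    dvr p%:R (x l - y l).
  move=> lo; have := e l; rewrite !ghost_split.
  rewrite opprD addrACA -mulrBr -sumrB => hd.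
  have [c] :
      dvr (p%:R ^+ l.+1) (p%:R ^+ l * (x l - y l)).
    rewrite -[X in dvr _ X](addrK (\sum_(j < m | (j < l)%N)
       (p%:R ^+ j * x j ^+ (p ^ (l - j)) - p%:R ^+ j * y j ^+ (p ^ (l - j))))).
    apply: dvrB => //; apply: dvr_sum => j lt_jl; rewrite -mulrBr.
    have -> : p%:R ^+ l.+1 = p%:R ^+ j * p%:R ^+ (l - j).+1 :> R.
      by rewrite -exprD addnS subnKC // ltnW.
    by apply: dvrM; [exists 1; rewrite mulr1 | apply/dvr_subXpn/lo].
  by rewrite exprSr -mulrA => /(preg_pow p_reg) ec; exists c.
elim: n i => [|n IH] i le_in; apply: step => j lt_ji.
  by move: (leq_trans lt_ji le_in).
by apply: IH; rewrite -ltnS (leq_trans lt_ji).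
Qed.

(** Extension by zero to all natural indices, so that sums over ['I_i.+1] can be
    split at either end. *)
Definition nat_component (R : nmodType) (x : W R) (j : nat) : R := oapp x 0 (insub j).

(** The composite of Verschiebung and Frobenius. *)
Definition witt_VF (R : pzSemiRingType) (x : W R) : W R :=
  [ffun i : 'I_m => if nat_of_ord i is j.+1 then nat_component x j ^+ p else 0 : R].

Lemma ghost_nat_component (R : comNzRingType) (x : W R) (i : 'I_m) :
  ghost p x i = \sum_(j < i.+1) p%:R ^+ j * nat_component x j ^+ (p ^ (i - j)).
Proof.
rewrite (big_ord_widen m (fun j => p%:R ^+ j * nat_component x j ^+ (p ^ (i - j)))) //.
by apply: eq_bigr => j _; rewrite /nat_component valK.
Qed.

Lemma nat_component_VF (R : comNzRingType) (x : W R) j : (j.+1 < m)%N ->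
  nat_component (witt_VF x) j.+1 = nat_component x j ^+ p.
Proof. by move=> lt_jm; rewrite {1}/nat_component insubT /= ffunE. Qed.

Lemma nat_component_VF0 (R : comNzRingType) (x : W R) : nat_component (witt_VF x) 0 = 0.
Proof. by rewrite /nat_component; case: insubP => //= u _ e; rewrite ffunE e. Qed.

Lemma ghost_mulrn (R : comNzRingType) (x : W R) n i :
  ghost p (x *+ n) i = n%:R * ghost p x i.
Proof.
elim: n => [|n IH]; first by rewrite mul0r [LHS]ghost0.
by rewrite mulrS [LHS]ghostD IH mulrS mulrDl mul1r.
Qed.

(** In characteristic [p], multiplication by [p] is [witt_VF]: over a ring without
    [p]-torsion the [i]-th ghost components of [p x] and [witt_VF x] differ by
    [p ^ (i + 1) * x i], so [ghost_dvr] applies. *)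
Lemma witt_mulp (R : comNzRingType) (x : W R) : p \in [pchar R] -> x *+ p = witt_VF x.
Proof.
move=> charR; have x0 : vanish_below 0 x by [].
have [S [f [u [_ [S_reg -> _ _]]]]] := vanish_lift x x0.
have -> : witt_map f u *+ p = witt_map f (u *+ p).
  elim: (X in _ *+ X = witt_map f (_ *+ X)) => [|n IH].
    by rewrite !mulr0n [RHS](@witt_map0 p p_pr m).
  by rewrite !mulrS IH [RHS]witt_mapD.
have dvp i : dvr p%:R ((u *+ p) i - witt_VF u i).
  apply: ghost_dvr => // {}i; rewrite ghost_mulrn !ghost_nat_component.
  rewrite [X in _ - X]big_ord_recl nat_component_VF0 expr0n expn_eq0.
  rewrite (gtn_eqF (prime_gt0 p_pr)) mulr0 add0r mulr_sumr.
  rewrite big_ord_recr /= subnn expr1 addrAC -sumrB big1 ?add0r.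
    by rewrite mulrA -exprS; exists (nat_component u i).
  move=> j _; rewrite /bump add1n nat_component_VF ?(leq_ltn_trans _ (ltn_ord i)) //.
  by rewrite mulrA -exprS -exprM -expnS subnSK ?subrr.
apply/ffunP => i; rewrite ffunE.
have [c /(canRL (subrK _)) ->] := dvp i.
rewrite rmorphD rmorphM rmorph_nat (pcharf0 charR) mul0r add0r !ffunE.
case: (nat_of_ord i) => [|j]; rewrite ?rmorph0 // rmorphXn /nat_component; congr (_ ^+ p).
by case: insub => [l|] /=; rewrite ?rmorph0 // ffunE.
Qed.

End LeadingComponents.

(** * Additive functions on a finite field *)

Section LinearizedPolynomials.
Variables (p : nat) (F : finFieldType).
Hypothesis charF : p \in [pchar F].

Lemma poly_eq_on_field (P Q : {poly F}) : (size P <= #|F|)%N ->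
  (size Q <= #|F|)%N -> (forall c, P.[c] = Q.[c]) -> P = Q.
Proof.
move=> sP sQ e; apply/eqP; rewrite -subr_eq0; apply/eqP.
apply: (@roots_geq_poly_eq0 F _ (enum F)).
- by apply/allP => c _; rewrite /root hornerD hornerN e subrr.
- by rewrite enum_uniq.
- by rewrite -cardE (leq_trans (size_polyD _ _)) // geq_max size_polyN sP.
Qed.

(** Lagrange interpolation, with [1 - (X - a) ^ (q - 1)] as the polynomial that is
    [1] at [a] and [0] elsewhere. *)
Lemma function_poly (f : F -> F) :
  exists2 P : {poly F}, (size P <= #|F|)%N & forall c, P.[c] = f c.
Proof.
have q_gt1 := finNzRing_gt1 F.
exists (\sum_(a : F) f a *: (1 - ('X - a%:P) ^+ #|F|.-1)).
  apply: (leq_trans (size_sum _ _ _)); apply/bigmax_leqP => a _.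
  apply: (leq_trans (size_scale_leq _ _)); apply: (leq_trans (size_polyD _ _)).
  by rewrite size_polyN size_exp_XsubC prednK ?(ltnW q_gt1) // size_poly1 geq_max ltnW /=.
move=> c; rewrite horner_sum (bigD1 c) //= big1 => [|a ne_ac].
  by rewrite addr0 !hornerE subrr expr0n -subn1 subn_eq0 leqNgt q_gt1 subr0 mulr1.
rewrite !hornerE (_ : (c - a) ^+ _ = 1) ?subrr ?mulr0 //.
have nz : c - a != 0 by rewrite subr_eq0 eq_sym.
apply: (mulfI nz); rewrite -exprS prednK ?(ltnW q_gt1) // mulr1.
exact: expf_card.
Qed.

Lemma pth_root s (a : F) : exists b, b ^+ (p ^ s) = a.
Proof.
have injX : injective (fun x : F => x ^+ p).
  by move=> x y; apply: (fmorph_inj (pFrobenius_aut charF)).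
elim: s a => [|s IH] a; first by exists a; rewrite expr1.
have [g _ gK] := injF_bij injX; have [b eb] := IH (g a).
by exists b; rewrite expnSr exprM eb gK.
Qed.

(** Additivity makes [P(X + c) - P(X)] constant, so that the derivative of [P]
    takes a single value [a] and is constant. Then [P - a X] has zero derivative: it
    involves only exponents divisible by [p], hence is the [p]-th power of a
    polynomial [g] over the perfect field [F]. As [g] is again additive, of degree
    [p] times smaller, induction applies to it. *)
Lemma additive_poly (P : {poly F}) e : (size P <= p ^ e <= #|F|)%N ->
  (forall a b, P.[a + b] = P.[a] + P.[b]) ->
  exists a : 'I_e -> F, forall c, P.[c] = \sum_(i < e) a i * c ^+ (p ^ i).
Proof.
have p_pr := pcharf_prime charF; have p_gt0 := prime_gt0 p_pr.
elim: e P => [|e IH] P /andP[sP le_peq] Padd.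
  exists (fun=> 0) => c; rewrite big_ord0.
  have PE b : P.[b] = P`_0 by rewrite {1}(size1_polyC sP) hornerC.
  by have := Padd 0 0; rewrite !PE => /(canLR (addrK _)); rewrite subrr.
have sPq := leq_trans sP le_peq.
have dP c : P^`().[c] = P^`().[0].
  have /(congr1 (fun Q => Q^`().[0])) : P \Po ('X + c%:P) = P + P.[c]%:P.
    apply: poly_eq_on_field => [||b]; last by rewrite horner_comp !hornerE Padd.
      by rewrite size_comp_poly2 // size_XaddC.
    rewrite (leq_trans (size_polyD _ _)) // geq_max sPq.
    by rewrite (leq_trans (size_polyC_leq1 _)) // ltnW // finNzRing_gt1.
  by rewrite deriv_comp !derivD derivX !derivC !addr0 mulr1 horner_comp !hornerE.
pose a := P^`().[0].
have dPE : P^`() = a%:P.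
  apply: poly_eq_on_field => [||c]; last by rewrite dP hornerC.
    by rewrite (leq_trans (leq_trans (size_poly _ _) (leq_pred _))).
  by rewrite (leq_trans (size_polyC_leq1 _)) // ltnW // finNzRing_gt1.
pose Q := P - a *: 'X.
have coefQ i : ~~ (p %| i)%N -> Q`_i = 0.
  case: i => [|i]; first by rewrite dvdn0.
  move=> ndv; have := congr1 (fun S : {poly F} => S`_i) dPE.
  rewrite coef_deriv coefC => e1.
  have nz : (i.+1%:R : F) != 0 by rewrite -(dvdn_pcharf charF).
  apply: (mulfI nz); rewrite mulr0 /Q coefB coefZ coefX mulrBr mulr_natl e1.
  by rewrite eqSS; case: (i == 0)%N / eqP => [->|_]; rewrite ?mulr0 ?subr0 // mul1r mulr1 subrr.
have sQ : (size Q <= p ^ e.+1)%N.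
  rewrite (leq_trans (size_polyD _ _)) // geq_max sP size_polyN.
  rewrite (leq_trans (size_scale_leq _ _)) // size_polyX.
  by rewrite (leq_trans (prime_gt1 p_pr)) // -{1}(expn1 p) leq_exp2l ?prime_gt1.
have [r rE] : exists r : 'I_(p ^ e) -> F, forall l : 'I_(p ^ e), r l ^+ p = Q`_(l * p).
  suff /fin_all_exists[r rE] (l : 'I_(p ^ e)) : exists b : F, b ^+ p = Q`_(l * p) by exists r.
  by have [b] := pth_root 1 Q`_(l * p); exists b.
pose r' l := oapp r 0 (insub l).
pose g := \poly_(l < p ^ e) r' l.
have gE c : g.[c] ^+ p = Q.[c].
  rewrite -[_ ^+ p]/(pFrobenius_aut charF _) horner_poly rmorph_sum /=.
  rewrite (horner_coef_wide c sQ).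
  rewrite [RHS](bigID (fun i : 'I__ => p %| i)%N) /= [X in _ + X]big1 ?addr0; last first.
    by move=> i /coefQ ->; rewrite mul0r.
  have ltm (l : 'I_(p ^ e)) : (l * p < p ^ e.+1)%N by rewrite expnSr ltn_mul2r p_gt0 ltn_ord.
  rewrite (reindex (fun l => Ordinal (ltm l))) /=; last first.
    have ltd (i : 'I_(p ^ e.+1)) : (i %/ p < p ^ e)%N.
      by rewrite ltn_divLR // -expnSr.
    exists (fun i => Ordinal (ltd i)) => i.
      by move=> _; apply: val_inj; rewrite /= mulnK.
    by rewrite inE => dv; apply: val_inj; rewrite /= divnK.
  apply: eq_big => [l|l _]; first by rewrite dvdn_mull.
  by rewrite rmorphM rmorphXn /= !pFrobenius_autE /r' valK /= rE -exprM mulnC.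
have injX : injective (fun x : F => x ^+ p).
  by move=> x y; apply: (fmorph_inj (pFrobenius_aut charF)).
have gadd x y : g.[x + y] = g.[x] + g.[y].
  apply: injX; rewrite gE -[RHS]/(pFrobenius_aut charF _) rmorphD /= !pFrobenius_autE !gE.
  by rewrite /Q !hornerE Padd mulrDr opprD addrACA !addrA.
have sg : (size g <= p ^ e <= #|F|)%N.
  by rewrite size_poly (leq_trans _ le_peq) // leq_exp2l ?prime_gt1.
have [b bE] := IH g sg gadd.
exists (fun i => oapp (fun j => b j ^+ p) a (unlift ord0 i)) => c.
rewrite big_ord_recl unlift_none /= expr1.
have -> : P.[c] = a * c + g.[c] ^+ p.
  by rewrite gE -[P in LHS](subrK (a *: 'X)) !hornerD hornerZ hornerX addrC.
rewrite bE -[_ ^+ p]/(pFrobenius_aut charF _) rmorph_sum; congr (_ + _).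
apply: eq_bigr => i _; rewrite liftK /= /bump add1n.
by rewrite rmorphM rmorphXn /= !pFrobenius_autE -exprM -expnS.
Qed.

Lemma additive_fun_poly n (f : F -> F) : #|F| = (p ^ n)%N ->
  (forall a b, f (a + b) = f a + f b) ->
  exists a : 'I_n -> F, forall c, f c = \sum_(i < n) a i * c ^+ (p ^ i).
Proof.
move=> cardF fadd; have [P sP PE] := function_poly f.
have [||a aE] := @additive_poly P n; first by rewrite -cardF sP leqnn.
  by move=> x y; rewrite !PE.
by exists a => c; rewrite -PE.
Qed.

End LinearizedPolynomials.

(** * Additive maps between Witt vectors over a finite field *)

Section WittMorphisms.
Variables (p : nat) (p_pr : prime p) (m : nat).
Local Notation W := (witt p_pr m).

Section Map.
Variables (R S : comNzRingType) (f : {rmorphism R -> S}).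
Fact witt_map_additive : zmod_morphism (witt_map f : W R -> W S).
Proof.
move=> x y; rewrite -[x - y]/(witt_add x (witt_opp y)).
by rewrite (@witt_mapD p p_pr m) (@witt_mapN p p_pr m).
Qed.
Fact witt_map_multiplicative : monoid_morphism (witt_map f : W R -> W S).
Proof. by split=> [|x y]; [exact: witt_map1 | exact: witt_mapM]. Qed.
HB.instance Definition _ :=
  GRing.isZmodMorphism.Build (W R) (W S) (witt_map f : W R -> W S) witt_map_additive.
HB.instance Definition _ :=
  GRing.isMonoidMorphism.Build (W R) (W S) (witt_map f : W R -> W S) witt_map_multiplicative.

Lemma witt_map_add (x y : W R) : witt_map f (x + y) = witt_map f x + witt_map f y.
Proof. exact: raddfD. Qed.

Lemma witt_map_sub (x y : W R) : witt_map f (x - y) = witt_map f x - witt_map f y.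
Proof. exact: raddfB. Qed.

Lemma witt_map_pow (x : W R) e : witt_map f (witt_pow x e) = witt_pow (witt_map f x) e.
Proof. by apply/ffunP => i; rewrite !ffunE rmorphXn. Qed.

Lemma witt_map_assoc_poly n (A : 'I_n -> W R) (x : W R) :
  witt_map f (assoc_poly A x) = assoc_poly (fun i => witt_map f (A i)) (witt_map f x).
Proof.
by rewrite raddf_sum; apply: eq_bigr => i _; rewrite [LHS]rmorphM /= witt_map_pow.
Qed.

End Map.

Section Frobenius.
Variable R : comNzRingType.
Hypothesis charR : p \in [pchar R].
Implicit Types x y : W R.

Lemma witt_powS x i :
  witt_pow x (p ^ i.+1) = witt_map (pFrobenius_aut charR) (witt_pow x (p ^ i)).
Proof. by apply/ffunP => j; rewrite !ffunE pFrobenius_autE expnSr exprM. Qed.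

Lemma witt_pow1 x : witt_pow x (p ^ 0) = x.
Proof. by apply/ffunP => j; rewrite ffunE expr1. Qed.

Lemma witt_powD x y i : witt_pow (x + y) (p ^ i) = witt_pow x (p ^ i) + witt_pow y (p ^ i).
Proof.
elim: i => [|i IH]; first by rewrite !witt_pow1.
by rewrite !witt_powS IH raddfD.
Qed.

Lemma witt_powB x y i : witt_pow (x - y) (p ^ i) = witt_pow x (p ^ i) - witt_pow y (p ^ i).
Proof. by apply/(canRL (addrK _)); rewrite -witt_powD subrK. Qed.

Lemma assoc_polyD n (A : 'I_n -> W R) x y :
  assoc_poly A (x + y) = assoc_poly A x + assoc_poly A y.
Proof. by rewrite -big_split; apply: eq_bigr => i _; rewrite witt_powD mulrDr. Qed.

Lemma assoc_polyB n (A : 'I_n -> W R) x y :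
  assoc_poly A (x - y) = assoc_poly A x - assoc_poly A y.
Proof. by apply/(canRL (addrK _)); rewrite -assoc_polyD subrK. Qed.

End Frobenius.

Section AdditiveMaps.
Variables (n : nat) (F : finFieldType).
Hypotheses (card_F : #|F| = (p ^ n)%N) (charF : p \in [pchar F]).

(** As [F] is perfect, Frobenius is onto, so that the image of [p = VF] is
    the whole image of [V], that is, the vectors that vanish below [1]. *)
Lemma vanish1_mulp (x : W F) : vanish_below 1 x -> exists y : W F, x = y *+ p.
Proof.
move=> x0.
have [r rE] : exists r : 'I_m -> F, forall i, r i ^+ p = nat_component x i.+1.
  suff /fin_all_exists[r rE] (i : 'I_m) : exists b : F, b ^+ p = nat_component x i.+1 by exists r.
  by have [b] := pth_root charF 1 (nat_component x i.+1); rewrite expn1; exists b.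
exists ([ffun i => r i] : {ffun 'I_m -> F}); rewrite (witt_mulp _ charF).
apply/ffunP => i; rewrite ffunE; case ei : (nat_of_ord i) => [|j]; first by rewrite x0 ?ei.
have lt_jm : (j < m)%N by rewrite ltnW // -ei.
rewrite /nat_component insubT /= ffunE rE /nat_component /=.
by rewrite -ei valK.
Qed.

(** Successive approximation along the filtration by [vanish_below s]. Suppose that
    [T] takes values that vanish below [s]. Leading components add, so that
    [x |-> (T x) s] is additive with values in a ring of characteristic [p]; it kills
    multiples of [p], that is, depends on [x 0] only. It is therefore a
    [p]-polynomial [t] in [x 0]. Taking for coefficients Witt vectors concentrated at
    [s] gives an associated polynomial with the same component at [s], and the
    difference with [T] takes values that vanish below [s + 1]. *)
Lemma additive_assoc_poly (T : W F -> W F) : {morph T : x y / x + y} ->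
  exists A : 'I_n -> W F, forall x, T x = assoc_poly A x.
Proof.
have vT : forall x, vanish_below 0 (T x) by [].
move: {2}m (subn0 m) => d; move: 0%N vT => s.
elim: d s T => [|d IH] s T vT ed TD.
  exists (fun=> 0) => x; rewrite (vanish_all _ (vT x)) //; last first.
    by rewrite -subn_eq0 ed.
  by rewrite /assoc_poly big1 // => i _; rewrite mul0r.
have lt_sm : (s < m)%N by rewrite -subn_gt0 ed.
have m_gt0 : (0 < m)%N by apply: leq_ltn_trans lt_sm.
pose os := Ordinal lt_sm; pose o0 := Ordinal m_gt0.
have TMn x k : T (x *+ k) = T x *+ k.
  have T0 : T 0 = 0 by apply: (addrI (T 0)); rewrite -TD !addr0.
  by elim: k => [|k IHk]; rewrite ?mulr0n // !mulrS TD IHk.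
have Ts_add x y : T (x + y) os = T x os + T y os.
  by rewrite TD (witt_add_vanish _ (vT x)).
have Ts_eq (x y : W F) : x o0 = y o0 -> T x os = T y os.
  move=> e; have [|w ew] := @vanish1_mulp (x - y).
    apply: vanish_sub => i; rewrite ltnS leqn0 => /eqP i0.
    by have -> : i = o0 by apply: val_inj.
  rewrite -[x](subrK y) Ts_add ew TMn.
  have -> k : (T w *+ k) os = T w os *+ k.
    elim: k => [|k IHk]; first by rewrite ffunE.
    by rewrite !mulrS (witt_add_vanish _ (vT w)) // IHk.
  by rewrite -mulr_natr (pcharf0 charF) mulr0 add0r.
pose cst (c : F) : W F := [ffun i : 'I_m => if i == 0 :> nat then c else 0].
have cst0 c : cst c o0 = c by rewrite ffunE.
(* A coefficient concentrated at s multiplies the p^s-th power of x 0, hence the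
   inverse g of that power. *)
have [g gK Kg] : bijective (fun c : F => c ^+ (p ^ s)).
  have [g gE] : exists g : F -> F, forall c, g c ^+ (p ^ s) = c.
    suff /fin_all_exists[g gE] (c : F) : exists b : F, b ^+ (p ^ s) = c by exists g.
    exact: pth_root.
  have gE' : cancel g (fun c => c ^+ (p ^ s)) by [].
  have g_inj := can_inj gE'.
  have [h hK gK] := injF_bij g_inj.
  by exists g => // c; rewrite -[c in LHS]gK gE gK.
have add_pow a b i : (a + b) ^+ (p ^ i) = a ^+ (p ^ i) + b ^+ (p ^ i) :> F.
  elim: i => [|i IHi]; first by rewrite !expr1.
  by rewrite expnSr !exprM IHi -!(pFrobenius_autE charF) raddfD.
have gD a b : g (a + b) = g a + g b.
  by apply: (can_inj gK); rewrite add_pow !Kg.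
have [a|b bE] := @additive_fun_poly p F charF n (fun c => T (cst (g c)) os) card_F.
  move=> c; rewrite -Ts_add; apply: Ts_eq.
  by rewrite (@witt_add_vanish _ _ _ _ 0) ?cst0 // gD.
pose B i : W F := [ffun j : 'I_m => if j == s :> nat then b i else 0].
have vB i : vanish_below s (B i) by move=> j lt_js; rewrite ffunE ltn_eqF.
have vBx x i : vanish_below s (B i * x) by apply: vanish_mul.
have vR x : vanish_below s (assoc_poly B x) by apply: vanish_sum.
have Rs x : assoc_poly B x os = T x os.
  rewrite (witt_sum_vanish (s := s)) //.
  have <- : T (cst (g (x o0 ^+ (p ^ s)))) os = T x os by apply: Ts_eq; rewrite cst0 gK.
  rewrite bE.
  apply: eq_bigr => i _; rewrite (witt_mul_vanish _ (vB i)) // ffunE /= eqxx.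
  by rewrite (ghost_pchar _ _ (i0 := o0) charF) // ffunE /= -!exprM mulnC.
have [|||A AE] := IH s.+1 (fun x => T x - assoc_poly B x).
- move=> x i; rewrite ltnS leq_eqVlt => /orP[/eqP ei|lt_is]; last first.
    apply: (@vanish_sub _ _ _ _ s) => // j lt_js.
    by rewrite vT // vR.
  apply: (@vanish_sub _ _ _ _ s.+1) => [j|]; last by rewrite ei.
  rewrite ltnS leq_eqVlt => /orP[/eqP ej|lt_js]; last by rewrite vT ?vR.
  by have -> : j = os by apply: val_inj.
- by rewrite subnS ed.
- by move=> x y /=; rewrite TD (assoc_polyD charF) opprD addrACA.
exists (fun i => A i + B i) => x; rewrite -[T x](subrK (assoc_poly B x)) AE.
by rewrite -big_split; apply: eq_bigr => i _; rewrite mulrDl.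
Qed.

End AdditiveMaps.
End WittMorphisms.

(** * Fields generated by elements, and the fixed field *)

HB.instance Definition _ (k K : fieldType) (j : k -> K) (s : Gal j) :=
  GRing.isZmodMorphism.Build K K s (gal_additive s).
HB.instance Definition _ (k K : fieldType) (j : k -> K) (s : Gal j) :=
  GRing.isMonoidMorphism.Build K K s (gal_multiplicative s).

Section Adjoin.
Variables (k E : fieldType) (iota : {rmorphism k -> E}).

Lemma adjoin_gen (I : Type) (y : I -> E) i : y i \in adjoin iota y.
Proof. by apply/asboolP. Qed.

Lemma adjoin_min (I : Type) (y : I -> E) (F : {pred E}) : divring_closed F ->
  (forall c, iota c \in F) -> (forall i, y i \in F) -> {subset adjoin iota y <= F}.
Proof. by move=> F_div Fk Fy u /asboolP; apply. Qed.

Lemma adjoin_sub (I J : Type) (y : I -> E) (z : J -> E) :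
  (forall j, z j \in adjoin iota y) -> {subset adjoin iota z <= adjoin iota y}.
Proof.
move=> zy; apply: adjoin_min => //; first exact: adjoin_divring_closed.
exact: adjoin_base.
Qed.

End Adjoin.

Section AdjoinField.
Variables (k E : fieldType) (iota : {rmorphism k -> E}).

Fact in_adjoin_field_additive (I : Type) (y : I -> E) :
  zmod_morphism (in_adjoin_field iota y).
Proof. by move=> a b; apply: val_inj; rewrite /= rmorphB. Qed.
Fact in_adjoin_field_multiplicative (I : Type) (y : I -> E) :
  monoid_morphism (in_adjoin_field iota y).
Proof. by split=> [|a b]; apply: val_inj; rewrite /= (rmorph1, rmorphM). Qed.
HB.instance Definition _ (I : Type) (y : I -> E) :=
  GRing.isZmodMorphism.Build k (adjoin_field iota y) (in_adjoin_field iota y)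
    (in_adjoin_field_additive y).
HB.instance Definition _ (I : Type) (y : I -> E) :=
  GRing.isMonoidMorphism.Build k (adjoin_field iota y) (in_adjoin_field iota y)
    (in_adjoin_field_multiplicative y).

(** The elements of [adjoin iota z] that come from the subfield generated by the
    lifts [zK] form a field that contains the base and the [z i]. *)
Lemma adjoin_field_gen (I J : Type) (y : I -> E) (z : J -> E)
    (zK : J -> adjoin_field iota y) : (forall i, val (zK i) = z i) ->
  {subset adjoin iota y <= adjoin iota z} ->
  forall u, u \in adjoin (in_adjoin_field iota y) zK.
Proof.
move=> zKE yz u; pose K := adjoin (in_adjoin_field iota y) zK; rewrite -/K.
pose F : {pred E} := fun v => `[< exists2 w : adjoin_field iota y, w \in K & val w = v >].
have : val u \in F.
  apply: (adjoin_min (F := F)) (yz _ (valP u)) => [|c|i].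
  - have [K1 KB KV] := adjoin_divring_closed (in_adjoin_field iota y) zK.
    split; first by apply/asboolP; exists 1.
      by move=> _ _ /asboolP[a Ka <-] /asboolP[b Kb <-]; apply/asboolP;
         exists (a - b); [exact: KB | rewrite rmorphB].
    by move=> _ _ /asboolP[a Ka <-] /asboolP[b Kb <-]; apply/asboolP;
       exists (a / b); [exact: KV | rewrite fmorph_div].
  - by apply/asboolP; exists (in_adjoin_field iota y c) => //; apply: adjoin_base.
  - by apply/asboolP; exists (zK i); [exact: (adjoin_gen (in_adjoin_field iota y) zK i) | exact: zKE].
by move=> /asboolP[w Kw /val_inj <-].
Qed.

(** A simple algebraic extension is a quotient of a polynomial ring: [subfx_inj]
    identifies an abstract copy of it with a subfield in which each element is, by
    construction, the value of a polynomial at [v]. *)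
Lemma adjoin_simple_poly (I J : Type) (y : I -> E) (y' : J -> E) (v : E)
    (P : {poly adjoin_field iota y}) :
  P \is monic -> root (map_poly val P) v ->
  (forall j, y' j \in adjoin iota y \/ y' j = v) ->
  forall u, u \in adjoin iota y' ->
  exists2 Q : {poly adjoin_field iota y}, (size Q < size P)%N & u = (map_poly val Q).[v].
Proof.
move=> P_monic Pv y'P u u_in.
have P_neq0 := monic_neq0 P_monic.
pose inj := @subfx_inj _ _ (val : {rmorphism adjoin_field iota y -> E}) v P.
pose F : {pred E} := fun a => `[< exists w, inj w = a >].
have Fin a : a \in adjoin iota y -> a \in F.
  move=> ha; apply/asboolP; exists (subfx_eval _ _ _ ((exist _ a ha : adjoin_field iota y)%:P)).
  by rewrite /inj subfx_inj_eval // map_polyC hornerC.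
have : u \in F.
  apply: (adjoin_min (F := F)) u_in => [|c|j].
  - split; first by apply/asboolP; exists 1; rewrite /inj rmorph1.
      by move=> _ _ /asboolP[a <-] /asboolP[b <-]; apply/asboolP;
         exists (a - b); rewrite /inj rmorphB.
    by move=> _ _ /asboolP[a <-] /asboolP[b <-]; apply/asboolP;
       exists (a / b); rewrite /inj fmorph_div.
  - by apply/Fin/adjoin_base.
  - case: (y'P j) => [/Fin //| ->]; apply/asboolP.
    by exists (subfx_root _ _ _); rewrite /inj subfx_inj_root.
move=> /asboolP[w <-]; have [Q ->] := subfxE w; rewrite /inj subfx_inj_eval //.
exists (Q %% P); first by rewrite ltn_modp.
rewrite {1}(divp_eq Q P) rmorphD rmorphM hornerD hornerM.
by rewrite (eqP Pv : _.[v] = 0) mulr0 add0r.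
Qed.

End AdjoinField.

Section FixedField.
Variables (p : nat) (p_pr : prime p) (n m : nat) (F : finFieldType).
Local Notation W := (witt p_pr m).
Variables (k K : fieldType) (j : {rmorphism k -> K}) (jF : {rmorphism F -> K}).
Hypothesis card_F : #|F| = (p ^ n)%N.
Variables (y : W K) (alpha : W k).
Hypothesis y_gen : forall u, u \in adjoin j y.
Hypothesis y_eq : witt_pow y (p ^ n) = y + witt_map j alpha.
Hypothesis y_conj : forall beta : W F,
  exists s : Gal j, witt_map s y = y + witt_map jF beta.

(** Truncations of [y] generate the steps of a tower between [k] and [K]. *)
Definition witt_trunc i : W K := [ffun l : 'I_m => if (l < i)%N then y l else 0].

(** Each step of the tower is an Artin-Schreier extension: [y] agrees up to [i]
    with the sum of [witt_trunc i] and a vector concentrated at [i], so that the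
    [i]-th component of [y ^ q = y + alpha] reads [y_i ^ q = y_i + c] with [c] in the
    field generated by the earlier components. *)
Lemma adjoin_trunc_step (i : 'I_m) u : u \in adjoin j (witt_trunc i.+1) ->
  exists2 Q : {poly adjoin_field j (witt_trunc i)},
    (size Q <= #|F|)%N & u = (map_poly val Q).[y i].
Proof.
have q_gt1 := finNzRing_gt1 F.
set L := adjoin_field j (witt_trunc i).
pose c := (witt_trunc i + witt_map j alpha) i.
have cL : c \in adjoin j (witt_trunc i).
  pose w : W L := [ffun l : 'I_m => exist _ (witt_trunc i l) (adjoin_gen j (witt_trunc i) l)].
  have -> : c = witt_map val (w + witt_map (in_adjoin_field j (witt_trunc i)) alpha) i.
    by rewrite /c raddfD; congr ((_ + _ : W K) i); apply/ffunP => l; rewrite !ffunE /= ?ffunE.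
  rewrite ffunE; exact: valP.
have yiq : y i ^+ #|F| = y i + c.
  have := congr1 (fun x : W K => x i) y_eq; rewrite ffunE -card_F => ->.
  pose yi : W K := [ffun l : 'I_m => if l == i then y i else 0].
  have vyi : vanish_below i yi by move=> l lt_li; rewrite ffunE -(inj_eq val_inj) ltn_eqF.
  rewrite (@witt_add_agree _ _ _ _ _ (yi + witt_trunc i)) => [|l le_li].
    by rewrite -addrA (witt_add_vanish _ vyi) // ffunE eqxx.
  rewrite (witt_add_vanish _ vyi) // !ffunE -(inj_eq val_inj) /= ltn_neqAle le_li andbT.
  by case: eqP => [e|_]; rewrite ?addr0 ?add0r //; congr (y _); apply: val_inj.
pose cL' : L := exist _ c cL.
pose P : {poly L} := 'X^#|F| - ('X + cL'%:P).
have sP : (size ('X + cL'%:P)%R <= #|F|)%N by rewrite size_XaddC.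
move=> u_in; have [||l|Q sQ uE] := @adjoin_simple_poly _ _ j _ _
  (witt_trunc i) (witt_trunc i.+1) (y i) P _ _ _ _ u_in.
- rewrite monicE lead_coefDl ?lead_coefXn //.
  by rewrite size_polyN size_polyXn ltnS.
- rewrite /root rmorphB rmorphXn rmorphD /= -[sval]/(val : L -> K) map_polyX map_polyC.
  by rewrite !hornerE yiq subrr.
- have [lt_li|] := boolP (l < i)%N.
    left; have := adjoin_gen j (witt_trunc i) l; rewrite !ffunE lt_li.
    by rewrite (ltn_trans lt_li).
  rewrite -leqNgt leq_eqVlt => /orP[/eqP/val_inj <-|lt_il].
    by right; rewrite ffunE ltnSn.
  by left; rewrite ffunE ltnS leqNgt lt_il rpred0.
exists Q => //; move: sQ.
by rewrite size_polyDl size_polyXn ?ltnS // size_polyN.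
Qed.

Lemma gal_fix_adjoin (s : Gal j) (x : W K) : (forall l, s (x l) = x l) ->
  forall u, u \in adjoin j x -> s u = u.
Proof.
move=> sx u u_in; apply/eqP.
apply: (adjoin_min (F := fun v => s v == v)) u_in => [|c|l]; last 2 first.
- by rewrite unfold_in gal_fix.
- by rewrite unfold_in sx.
split; first by rewrite unfold_in rmorph1.
  by move=> a b; rewrite !unfold_in => /eqP ea /eqP eb; rewrite rmorphB /= ea eb.
by move=> a b; rewrite !unfold_in => /eqP ea /eqP eb; rewrite fmorph_div /= ea eb.
Qed.

(** A fixed element [u] descends one step of the tower. Write [u = Q(y_i)] with
    [deg Q < q]. For [b] in [F], the automorphism attached to the Witt vector
    concentrated at [i] with component [b] fixes the earlier components of [y], hence
    the coefficients of [Q], and sends [y_i] to [y_i + b]. So [Q - u] has [q] roots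
    and [u] is the constant coefficient of [Q]. *)
Lemma fixed_adjoin_trunc i u : (i <= m)%N -> (forall s : Gal j, s u = u) ->
  u \in adjoin j (witt_trunc (m - i)).
Proof.
move=> + u_fix; elim: i => [|i IH] lt_im.
  suff -> : witt_trunc (m - 0) = y by apply: y_gen.
  by apply/ffunP => l; rewrite ffunE subn0 ltn_ord.
have := IH (ltnW lt_im); rewrite -subnSK // => u_in.
have lt_m : (m - i.+1 < m)%N by rewrite subnSK // leq_subr.
pose l := Ordinal lt_m; rewrite -[(m - i.+1)%N]/(l : nat) in u_in *.
move: l u_in => {IH lt_m lt_im i} i u_in.
have [Q sQ uE] := adjoin_trunc_step u_in.
have Qu b : (map_poly val Q).[y i + jF b] = u.
  pose beta : W F := [ffun l : 'I_m => if l == i then b else 0].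
  have vb : vanish_below i beta by move=> l lt_li; rewrite ffunE -(inj_eq val_inj) ltn_eqF.
  have vjb : vanish_below i (witt_map jF beta).
    by move=> l lt_li; rewrite ffunE vb ?rmorph0.
  have [s sy] := y_conj beta.
  have syl (l : 'I_m) : (l <= i)%N -> s (y l) = y l + jF (beta l).
    move=> le_li; have := congr1 (fun x : W K => x l) sy.
    by rewrite ffunE addrC (witt_add_vanish _ vjb) // ffunE addrC.
  have sL a : a \in adjoin j (witt_trunc i) -> s a = a.
    apply: gal_fix_adjoin => l; rewrite ffunE; case: ifP => [lt_li|_]; last exact: rmorph0.
    by rewrite syl ?(ltnW lt_li) // vb // rmorph0 addr0.
  rewrite -[RHS](u_fix s) uE -horner_map /= syl // ffunE eqxx -map_poly_comp.
  congr (_.[_]); apply: eq_map_poly => a /=.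
  by rewrite sL //; apply: valP.
have : map_poly val Q - u%:P = 0.
  apply: (@roots_geq_poly_eq0 K _ [seq y i + jF b | b <- enum F]).
  - by apply/allP => _ /mapP[b _ ->]; rewrite /root !hornerE Qu subrr.
  - by rewrite map_inj_uniq ?enum_uniq // => a b /addrI /fmorph_inj.
  rewrite size_map -cardE (leq_trans (size_polyD _ _)) // geq_max size_map_poly sQ.
  rewrite size_polyN (leq_trans (size_polyC_leq1 _)) // ltnW //.
  exact: finNzRing_gt1.
move=> /eqP; rewrite subr_eq0 => /eqP /(congr1 (fun R : {poly K} => R`_0)).
by rewrite coefC coef_map /= => <-; apply: valP.
Qed.

Lemma fixed_field u : (forall s : Gal j, s u = u) -> exists c, u = j c.
Proof.
move=> /(fixed_adjoin_trunc (leqnn m)); rewrite subnn => u_in.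
pose J : {pred K} := fun v => `[< exists c, v = j c >].
suff: u \in J by move/asboolP.
apply: adjoin_min u_in => [|c|l]; last 2 first.
- by apply/asboolP; exists c.
- by apply/asboolP; exists 0; rewrite ffunE rmorph0.
split; first by apply/asboolP; exists 1; rewrite rmorph1.
  by move=> _ _ /asboolP[a ->] /asboolP[b ->]; apply/asboolP; exists (a - b); rewrite rmorphB.
by move=> _ _ /asboolP[a ->] /asboolP[b ->]; apply/asboolP; exists (a / b); rewrite fmorph_div.
Qed.

End FixedField.

(** * Artin-Schreier-Witt extensions *)

Section ArtinSchreierWitt.
Variables (p : nat) (p_pr : prime p) (n m : nat) (F : finFieldType).
Local Notation W := (witt p_pr m).
Variables (k K : fieldType) (j : {rmorphism k -> K}) (jF : {rmorphism F -> k}).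
Hypotheses (card_F : #|F| = (p ^ n)%N) (char_k : p \in [pchar k]).

Local Notation inK := (witt_map (j \o jF)).

Let char_K : p \in [pchar K].
Proof. by rewrite (fmorph_pchar j). Qed.

Let char_F : p \in [pchar F].
Proof. by rewrite -(fmorph_pchar jF). Qed.

Lemma inK_inj : injective (inK : W F -> W K).
Proof.
move=> a b /ffunP e; apply/ffunP => i; have := e i; rewrite !ffunE.
exact: fmorph_inj.
Qed.

(** The components are roots of [X ^ q - X], which splits over [F]. *)
Lemma witt_pow_fixed (x : W K) : witt_pow x (p ^ n) = x -> exists b : W F, x = inK b.
Proof.
move=> ex; have [b bE] : exists b : 'I_m -> F, forall i, j (jF (b i)) = x i.
  suff /fin_all_exists[b bE] (i : 'I_m) : exists c, j (jF c) = x i by exists b.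
  have := congr1 (fun P => (map_poly (j \o jF) P).[x i]) (finField_genPoly F).
  rewrite rmorphB /= map_polyXn map_polyX rmorph_prod horner_prod /= !hornerE.
  have -> : x i ^+ #|F| = x i.
    by have := congr1 (fun w : W K => w i) ex; rewrite ffunE card_F.
  rewrite subrr => /esym/eqP/prodf_eq0[c _].
  rewrite rmorphB /= map_polyX map_polyC !hornerE subr_eq0 => /eqP->.
  by exists c.
by exists [ffun i => b i]; apply/ffunP => i; rewrite !ffunE /= bE.
Qed.

Lemma gal_inK (s : Gal j) (b : W F) : witt_map s (inK b) = inK b.
Proof. by apply/ffunP => i; rewrite !ffunE /= gal_fix. Qed.

Lemma gal_map (s : Gal j) (a : W k) : witt_map s (witt_map j a) = witt_map j a.
Proof. by apply/ffunP => i; rewrite !ffunE /= gal_fix. Qed.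

Section Character.
Variables (x : W K) (a : W k).
Hypothesis x_eq : witt_pow x (p ^ n) - x = witt_map j a.

Lemma gal_shift (s : Gal j) : exists b : W F, witt_map s x = x + inK b.
Proof.
have [|b bE] := @witt_pow_fixed (witt_map s x - x).
  rewrite (witt_powB char_K) -witt_map_pow.
  have -> : witt_pow x (p ^ n) = x + witt_map j a by rewrite -x_eq addrC subrK.
  by rewrite witt_map_add gal_map opprD addrACA subrr addr0.
by exists b; rewrite -bE addrC subrK.
Qed.

(** The additive character by which [Gal j] translates a solution of the
    Artin-Schreier-Witt equation. *)
Definition shift (s : Gal j) : W F := sval (cid (gal_shift s)).

Lemma shiftE (s : Gal j) : witt_map s x = x + inK (shift s).
Proof. exact: svalP (cid (gal_shift s)). Qed.

Lemma shift_uniq (s : Gal j) b : witt_map s x = x + inK b -> shift s = b.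
Proof. by rewrite shiftE => /addrI /inK_inj. Qed.

Lemma shiftM (s t : Gal j) : shift (s * t)%g = shift s + shift t.
Proof.
apply: shift_uniq; rewrite (raddfD (inK : {additive W F -> W K})) addrA -shiftE.
transitivity (witt_map s (witt_map t x)).
  by apply/ffunP => i; rewrite !ffunE.
by rewrite shiftE witt_map_add gal_inK.
Qed.

Lemma shift_assoc_poly (s : Gal j) l (A : 'I_l -> W F) :
  witt_map s (assoc_poly (fun i => inK (A i)) x) =
  assoc_poly (fun i => inK (A i)) x + inK (assoc_poly A (shift s)).
Proof.
rewrite !witt_map_assoc_poly -(assoc_polyD char_K) -shiftE.
by apply: eq_bigr => i _; rewrite gal_inK.
Qed.

Lemma shift_inj : (forall u, u \in adjoin j x) -> injective shift.
Proof.
move=> x_gen s t e; apply: gal_eq => u.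
pose G : {pred K} := fun v => s v == t v.
suff /eqP : u \in G by [].
apply: adjoin_min (x_gen u) => [|c|i].
- split; first by rewrite unfold_in !rmorph1.
    by move=> b c; rewrite !unfold_in => /eqP eb /eqP ec; rewrite !rmorphB /= eb ec.
  by move=> b c; rewrite !unfold_in => /eqP eb /eqP ec; rewrite !fmorph_div /= eb ec.
- by rewrite unfold_in !gal_fix.
- have : witt_map s x = witt_map t x by rewrite !shiftE e.
  by move=> /ffunP/(_ i); rewrite !ffunE => ei; rewrite unfold_in ei.
Qed.

End Character.

Lemma inj_assoc_poly (f : W F -> W F) : {morph f : a b / a + b} -> injective f ->
  exists A : 'I_n -> W F,
    (forall b, f b = assoc_poly A b) /\ (forall b, assoc_poly A b = 0 <-> b = 0).
Proof.
move=> fD f_inj; have [A AE] := additive_assoc_poly card_F char_F fD.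
have f0 : f 0 = 0 by apply: (addrI (f 0)); rewrite -fD !addr0.
exists A; split=> // b; rewrite -AE; split=> [e|->] //.
by apply: f_inj; rewrite f0.
Qed.

Variables (y z : W K) (alpha beta0 : W k).
Hypothesis y_gen : forall u, u \in adjoin j y.
Hypothesis y_eq : witt_pow y (p ^ n) - y = witt_map j alpha.
Hypothesis z_eq : witt_pow z (p ^ n) - z = witt_map j beta0.
Variable phi : Gal j -> W F.
Hypothesis phi_bij : bijective phi.

(** [shift] is injective because [y] generates [K], and [phi] says that its source
    has as many elements as its target. *)
Lemma shift_surj : exists g : W F -> Gal j, cancel g (shift y_eq).
Proof.
have [psi phiK psiK] := phi_bij.
have inj : injective (fun b => shift y_eq (psi b)).
  by apply: inj_comp (can_inj psiK); apply: shift_inj.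
have [h _ hK] := injF_bij inj.
by exists (psi \o h).
Qed.

Lemma witt_fixed (x : W K) : (forall s : Gal j, witt_map s x = x) ->
  exists D : W k, x = witt_map j D.
Proof.
move=> x_fix; have [g gK] := shift_surj.
suff /fin_all_exists[D DE] (i : 'I_m) : exists c, x i = j c.
  by exists [ffun i => D i]; apply/ffunP => i; rewrite !ffunE.
apply: (@fixed_field p p_pr n m F k K j (j \o jF) card_F y alpha) => //.
- by rewrite -y_eq addrC subrK.
- by move=> b; exists (g b); rewrite -{2}(gK b) -shiftE.
- by move=> s; have := congr1 (fun w : W K => w i) (x_fix s); rewrite ffunE.
Qed.

(** When both [y] and [z] generate [K], their shifts are bijections onto [W F], and
    [shift z] composed with the inverse of [shift y] is an additive bijection, hence
    some [assoc_poly A]. Then every automorphism translates [z] and [assoc_poly A y]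
    by the same vector, so their difference is fixed. *)
Lemma assoc_poly_of_gen : (forall u, u \in adjoin j z) ->
  exists A : 'I_n -> W F, (forall b, assoc_poly A b = 0 <-> b = 0) /\
    exists D : W k, z = assoc_poly (fun i => inK (A i)) y + witt_map j D.
Proof.
move=> z_gen; have [g gK] := shift_surj.
have y_inj := shift_inj (x_eq := y_eq) y_gen.
have z_inj := shift_inj (x_eq := z_eq) z_gen.
have gD b c : g (b + c) = (g b * g c)%g by apply: y_inj; rewrite shiftM !gK.
have [b c||A [AE A0]] := @inj_assoc_poly (shift z_eq \o g).
- by rewrite /= gD shiftM.
- by apply: inj_comp (can_inj gK).
exists A; split=> //.
have [s|D DE] := @witt_fixed (z - assoc_poly (fun i => inK (A i)) y).
  rewrite witt_map_sub (shift_assoc_poly y_eq) (shiftE z_eq) -AE /=.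
  have -> : g (shift y_eq s) = s by apply: y_inj; rewrite gK.
  by rewrite opprD addrACA subrr addr0.
by exists D; rewrite -DE addrC subrK.
Qed.

(** The inverse of [assoc_poly A] on [W F] is additive, hence some [assoc_poly A'].
    Applied to [z], it yields a vector that every automorphism translates in the
    same way as [y]. *)
Lemma gen_of_assoc_poly (A : 'I_n -> W F) (D : W k) :
  (forall b, assoc_poly A b = 0 <-> b = 0) ->
  z = assoc_poly (fun i => inK (A i)) y + witt_map j D ->
  exists (A' : 'I_n -> W F) (D' : W k),
    y = assoc_poly (fun i => inK (A' i)) z + witt_map j D'.
Proof.
move=> A0 zE.
have A_inj : injective (assoc_poly A).
  move=> b c e; apply/eqP; rewrite -subr_eq0; apply/eqP/A0.
  by rewrite (assoc_polyB char_F) e subrr.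
have [f fK Kf] := injF_bij A_inj.
have [b c||A' [A'E _]] := @inj_assoc_poly f.
- by apply: A_inj; rewrite (assoc_polyD char_F) !Kf.
- exact: can_inj Kf.
have [s|D' DE] := @witt_fixed (y - assoc_poly (fun i => inK (A' i)) z).
  rewrite witt_map_sub (shift_assoc_poly z_eq) (shiftE y_eq) -A'E.
  have -> : shift z_eq s = assoc_poly A (shift y_eq s).
    apply: shift_uniq; rewrite zE witt_map_add gal_map (shift_assoc_poly y_eq).
    by rewrite addrAC.
  by rewrite fK opprD addrACA subrr addr0.
by exists A', D'; rewrite -DE addrC subrK.
Qed.

End ArtinSchreierWitt.

Section AssocPolyAdjoin.
Variables (p : nat) (p_pr : prime p) (n m : nat) (F : finFieldType).
Local Notation W := (witt p_pr m).
Variables (k E : fieldType) (iota : {rmorphism k -> E}) (jF : {rmorphism F -> k}).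

Lemma witt_adjoin_lift (y x : W E) : (forall i, x i \in adjoin iota y) ->
  exists xK : W (adjoin_field iota y), x = witt_map val xK.
Proof.
move=> xy; exists [ffun i : 'I_m => exist _ (x i) (xy i)].
by apply/ffunP => i; rewrite !ffunE.
Qed.

Lemma assoc_poly_val (y : W E) (A : 'I_n -> W F) (x : W (adjoin_field iota y)) (D : W k) :
  assoc_poly (fun l => witt_map (iota \o jF) (A l)) (witt_map val x) + witt_map iota D =
  witt_map val (assoc_poly (fun l => witt_map (in_adjoin_field iota y \o jF) (A l)) x +
                witt_map (in_adjoin_field iota y) D).
Proof.
rewrite witt_map_add witt_map_assoc_poly; congr (_ + _); last first.
  by apply/ffunP => l; rewrite !ffunE.
by apply: eq_bigr => l _; congr (_ * _); apply/ffunP => i; rewrite !ffunE.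
Qed.

Lemma assoc_poly_adjoin (A : 'I_n -> W F) (x : W E) (D : W k) i :
  (assoc_poly (fun l => witt_map (iota \o jF) (A l)) x + witt_map iota D) i
    \in adjoin iota x.
Proof.
have [xL xE] := witt_adjoin_lift (adjoin_gen iota x).
by rewrite [X in assoc_poly _ X]xE assoc_poly_val ffunE; apply: valP.
Qed.

End AssocPolyAdjoin.

Theorem theorem8p9 (p : nat) (p_pr : prime p) (n m : nat)
    (Fq : finFieldType) (card_Fq : #|Fq| = (p ^ n)%N)
    (k : fieldType) (char_k : p \in [pchar k]) (jq : {rmorphism Fq -> k})
    (kbar : closedFieldType) (iota : {rmorphism k -> kbar})
    (kbar_alg : forall u : kbar, algebraicOver iota u)
    (y z : witt p_pr m kbar) (alpha beta0 : witt p_pr m k)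
    (y_eq : witt_pow y (p ^ n) - y = witt_map iota alpha)
    (galK : exists phi : Gal (in_adjoin_field iota y) -> witt p_pr m Fq,
       bijective phi /\ {morph phi : s t / (s * t)%g >-> s + t})
    (z_eq : witt_pow z (p ^ n) - z = witt_map iota beta0) :
  adjoin iota y =i adjoin iota z <->
  exists A : 'I_n -> witt p_pr m Fq,
    (forall beta : witt p_pr m Fq, assoc_poly A beta = 0 <-> beta = 0) /\
    exists D : witt p_pr m k,
      z = assoc_poly (fun i => witt_map (iota \o jq) (A i)) y + witt_map iota D.
Proof.
have [phi [phi_bij _]] := galK.
pose K := adjoin_field iota y; pose j := in_adjoin_field iota y.
have val_inj' : injective (witt_map val : witt p_pr m K -> witt p_pr m kbar).
  move=> a b /ffunP e; apply/ffunP => i; apply: val_inj.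
  by have := e i; rewrite !ffunE.
have map_j (a : witt p_pr m k) : witt_map iota a = witt_map val (witt_map j a).
  by apply/ffunP => i; rewrite !ffunE.
have eq_val (x : witt p_pr m K) (a : witt p_pr m k) :
    witt_pow (witt_map val x) (p ^ n) - witt_map val x = witt_map iota a ->
    witt_pow x (p ^ n) - x = witt_map j a.
  by move=> e; apply: val_inj'; rewrite witt_map_sub witt_map_pow e map_j.
have [yK yKE] := witt_adjoin_lift (adjoin_gen iota y).
have yK_gen : forall u, u \in adjoin j yK.
  by apply: (adjoin_field_gen (z := y)) => // i; rewrite [in RHS]yKE ffunE.
have yK_eq : witt_pow yK (p ^ n) - yK = witt_map j alpha.
  by apply: eq_val; rewrite -yKE.
split=> [eq_yz|[A [A0 [D zE]]]].
  have [i|zK zKE] := @witt_adjoin_lift p p_pr m k kbar iota y z.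
    by rewrite eq_yz adjoin_gen.
  have zK_eq : witt_pow zK (p ^ n) - zK = witt_map j beta0.
    by apply: eq_val; rewrite -zKE.
  have zK_gen : forall u, u \in adjoin j zK.
    apply: (adjoin_field_gen (z := z)) => [i|u]; first by rewrite [in RHS]zKE ffunE.
    by rewrite eq_yz.
  have [A [A0 [D zKD]]] :=
    assoc_poly_of_gen jq card_Fq char_k yK_gen yK_eq zK_eq phi_bij zK_gen.
  exists A; split=> //; exists D.
  by rewrite zKE zKD -assoc_poly_val -yKE.
have [i|zK zKE] := @witt_adjoin_lift p p_pr m k kbar iota y z.
  by rewrite zE assoc_poly_adjoin.
have zK_eq : witt_pow zK (p ^ n) - zK = witt_map j beta0.
  by apply: eq_val; rewrite -zKE.
have zKD : zK = assoc_poly (fun i => witt_map (j \o jq) (A i)) yK + witt_map j D.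
  by apply: val_inj'; rewrite -assoc_poly_val -yKE -zKE.
have [A' [D' yKD]] := gen_of_assoc_poly card_Fq char_k yK_gen yK_eq zK_eq phi_bij A0 zKD.
have yE : y = assoc_poly (fun i => witt_map (iota \o jq) (A' i)) z + witt_map iota D'.
  by rewrite zKE assoc_poly_val -yKD.
move=> u; apply/idP/idP; apply: adjoin_sub => i.
  by rewrite yE assoc_poly_adjoin.
by rewrite zE assoc_poly_adjoin.
Qed.
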